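(* Let $K$ be an algebraically closed field with $\mathrm{char}(K)\neq 2$, let $\Lambda$ be a finite-dimensional $K$-algebra with an action of a finite abelian group $G$ as described in the context, let $\bar\Lambda$ be the skew group algebra, and suppose that $F_\lambda:\mathrm{mod}\text{-}\Lambda\to\mathrm{mod}\text{-}\bar\Lambda$ is a Galois semi-covering. Let $\theta$ be a finitely presented semisimple $\Lambda$-module and put $\tilde\theta=F_\lambda(\theta)$. For a $\theta$-pointed module $(M;\chi_M)$ put $\chi_{F_\lambda(M)}=F_\lambda(\chi_M):\tilde\theta\to F_\lambda(M)$. (1) If $\big((M_q;\chi_{M_q})_{q\in L_1},(N_t;\chi_{N_t})_{t\in L_2}\big)$ is a non-symmetric independent pair of dense chains of $\theta$-pointed $\Lambda$-modules, then $\big((F_\lambda(M_q);\chi_{F_\lambda(M_q)})_{q\in L_1},(F_\lambda(N_t);\chi_{F_\lambda(N_t)})_{t\in L_2}\big)$ is an independent pair of dense chains of $\tilde\theta$-pointed $\bar\Lambda$-modules. (2) If $\{\overline{(M_p;\chi_{M_p})}\}_{p\in L_1}$ is a wide poset of $\theta$-pointed modules in $\mathcal{P}^{\theta}_{\Lambda}$, then $\{\overline{(F_\lambda(M_p);\chi_{F_\lambda(M_p)})}\}_{p\in L_1}$ is a wide poset of $\tilde\theta$-pointed modules in $\mathcal{P}^{\tilde\theta}_{\bar\Lambda}$.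
   Context: **Group action and skew group algebra.** $\Lambda=KQ/I$ is a finite-dimensional bound quiver algebra over $K$. $G$ is a finite abelian group of order $n$ acting on $KQ$, and on $\Lambda$ by $K$-algebra automorphisms, permuting the vertices of $Q$, such that every vertex $i$ whose stabilizer $G_i$ is different from $G$ has a $G$-orbit of cardinality $n$. The group $\hat G$ of irreducible representations of $G$ over $K$ (under tensor product) has order $n$. The skew group algebra $\bar\Lambda$ has underlying vector space $\Lambda\otimes_K KG$ and multiplication $(\lambda\otimes g)(\mu\otimes h)=\lambda\, g(\mu)\otimes gh$. For a $\Lambda$-module $M$ and $g\in G$, ${}^gM$ denotes the module $M$ twisted by $g^{-1}$ (i.e. $M\circ g^{-1}$ when $M$ is viewed as a representation/functor). **The functor $F_\lambda$.** $F_\lambda:\mathrm{mod}\text{-}\Lambda\to\mathrm{mod}\text{-}\bar\Lambda$ (finite-dimensional modules) is the push-down functor; it is the functor $\bar\Lambda\otimes_\Lambda-$ (up to equivalence). Put $G_M=\{g\in G: {}^gM\cong M\}$ and $G_{MN}=G_M\cap G_N$. $F_\lambda$ being a Galois semi-covering means that it induces isomorphisms of vector spaces $$\mathrm{Hom}_{\bar\Lambda}(F_\lambda M,F_\lambda N)\cong\begin{cases}\bigoplus_{g\in G}\mathrm{Hom}_\Lambda({}^gM,N)&\text{if }G_M\neq G,\\ \bigoplus_{g\in G}\mathrm{Hom}_\Lambda(M,{}^gN)&\text{if }G_N\neq G,\\ \mathrm{Hom}_\Lambda(M,N)^{|G|}&\text{if }G_{MN}=G.\end{cases}$$ **Pointed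 modules.** Let $A$ be a finite-dimensional algebra and $\theta$ a finitely presented $A$-module. A $\theta$-pointed $A$-module is a pair $(M;\chi_M)$ with $M$ a finitely presented $A$-module and $\chi_M:\theta\to M$ a homomorphism. A pointed homomorphism $(M;\chi_M)\to(N;\chi_N)$ is a homomorphism $f:M\to N$ with $f\chi_M=\chi_N$; it is a $\theta$-isomorphism if $f$ is an isomorphism. Write $(M;\chi_M)\equiv(N;\chi_N)$ if there are pointed homomorphisms in both directions. $\mathcal{P}_A^\theta$ is the set of $\equiv$-classes $\overline{(M;\chi_M)}$, ordered by $\overline{(M;\chi_M)}\le\overline{(N;\chi_N)}$ iff there is a pointed homomorphism $(N;\chi_N)\to(M;\chi_M)$. It is a modular lattice whose supremum is induced by the pointed direct sum $(M\oplus N;\chi_{M\oplus N})$, $\chi_{M\oplus N}(l)=(\chi_M(l),\chi_N(l))$, and whose infimum is induced by the pointed pushout $(M;\chi_M)\ast(N;\chi_N)=(M\ast N;\chi_{M\ast N})$, where $M\ast N=(M\oplus N)/\{(\chi_M(l),-\chi_N(l)):l\in\theta\}$ and $\chi_{M\ast N}(l)=\overline{(\chi_M(l),0)}=\overline{(0,\chi_N(l))}$. **Dense chains.** A $\mathcal Q$-chain is a poset isomorphic to the rationals with their usual order. For a $\mathcal Q$-chain $C$, a dense chain of $\theta$-pointed $A$-modules is a family $(M_q;\chi_{M_q})_{q\in C}$ of $\theta$-pointed $A$-modules such that: (i) $\mathrm{End}_A(M_q)$ is local and $\chi_{M_q}\ne0$ for all $q$; (ii) for $q<q'$ there is a pointed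 homomorphism $(M_q;\chi_{M_q})\to(M_{q'};\chi_{M_{q'}})$; (iii) for $q\ne q'$ the pointed modules $(M_q;\chi_{M_q})$ and $(M_{q'};\chi_{M_{q'}})$ are not isomorphic. An independent pair of dense chains of $\theta$-pointed $A$-modules is a pair $((M_q;\chi_{M_q})_{q\in C_1},(N_t;\chi_{N_t})_{t\in C_2})$ of dense chains such that $\mathrm{End}_A(M_q\ast N_t)$ is local for all $q,t$, and $(M_q;\chi_{M_q})\ast(N_t;\chi_{N_t})$ is $\theta$-isomorphic neither to $(M_{q'};\chi_{M_{q'}})\ast(N_t;\chi_{N_t})$ nor to $(M_q;\chi_{M_q})\ast(N_{t'};\chi_{N_{t'}})$ for all $q\neq q'$ in $C_1$ and $t\neq t'$ in $C_2$. An independent pair over $\Lambda$ is non-symmetric if for every non-identity $g\in G$ and all $q_1,q_2\in C_1$, $t_1,t_2\in C_2$: ${}^gM_{q_1}\not\cong M_{q_2}$, ${}^gN_{t_1}\not\cong N_{t_2}$, and ${}^g(M_{q_1}\ast N_{t_1})\not\cong M_{q_2}\ast N_{t_2}$ (as modules). **Wide posets.** A subset $\mathcal L\subseteq\mathcal P_A^\theta$ is wide if for all $\overline{(M_p;\chi_{M_p})}<\overline{(M_q;\chi_{M_q})}$ in $\mathcal L$ there are incomparable elements $\overline{(M;\chi_M)},\overline{(N;\chi_N)}$ of $\mathcal L$, each lying strictly between them, such that $$\overline{(M_p;\chi_{M_p})}<\overline{(M\ast N;\chi_{M\ast N})}<\overline{(M\oplus N;\chi_{M\oplus N})}<\overline{(M_q;\chi_{M_q})}.$$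 *)

(* Defs.v *)
From HB Require Import structures.
From mathcomp Require Import all_boot all_order all_algebra.
From mathcomp Require Import all_fingroup all_solvable all_field all_character.
From mathcomp Require Import finmap.
From mathcomp Require Import monalg.

Set Implicit Arguments.
Unset Strict Implicit.
Unset Printing Implicit Defensive.

Import GRing.Theory.

Local Open Scope ring_scope.

(** * Path algebras *)

Record quiver := Quiver {
  qvert : finType;
  qarr : finType;
  qsrc : qarr -> qvert;
  qtgt : qarr -> qvert;
  qvert_nonempty : (0 < #|qvert|)%N }.

Section Paths.
Variable Q : quiver.

(* [composable v w]: the arrows [w] can be traversed in this order from [v]. *)
Fixpoint composable (v : qvert Q) (w : seq (qarr Q)) : bool :=
  if w is a :: w' then (qsrc a == v) && composable (qtgt a) w' else true.

Definition walk_end (v : qvert Q) (w : seq (qarr Q)) : qvert Q :=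
  foldl (fun _ a => qtgt a) v w.

(* The pair [(v, [::])] is the trivial path at [v]. *)
Record qpath := QPath {
  pval : qvert Q * seq (qarr Q);
  pvalP : composable pval.1 pval.2 }.

HB.instance Definition _ := [isSub for pval].
HB.instance Definition _ := [Choice of qpath by <:].

Definition psrc (p : qpath) := (pval p).1.
Definition parr (p : qpath) := (pval p).2.
Definition pend (p : qpath) := walk_end (psrc p) (parr p).
Definition plen (p : qpath) := size (parr p).

Definition ptriv (v : qvert Q) : qpath := @QPath (v, [::]) isT.

Lemma composable_cat v w1 w2 :
  composable v (w1 ++ w2) = composable v w1 && composable (walk_end v w1) w2.
Proof.
elim: w1 v => [|a w1 IH] v //=.
by rewrite IH andbA.
Qed.

Lemma pcat_subproof (p q : qpath) : pend p == psrc q ->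
  composable (psrc p, parr p ++ parr q).1 (psrc p, parr p ++ parr q).2.
Proof.
move=> /= /eqP e; rewrite composable_cat.
by rewrite (pvalP p) /= -/(pend p) e (pvalP q).
Qed.

Definition pcat (p q : qpath) (e : pend p == psrc q) : qpath :=
  QPath (pcat_subproof e).

(* First [p], then [q]. *)
Definition pcomp (p q : qpath) : option qpath :=
  if @idP (pend p == psrc q) is ReflectT e then Some (pcat e) else None.

Variant pcomp_spec (p q : qpath) : option qpath -> Type :=
| PComp r of pend p = psrc q & psrc r = psrc p & parr r = parr p ++ parr q :
    pcomp_spec p q (Some r)
| PNone of pend p <> psrc q : pcomp_spec p q None.

Lemma pcompP p q : pcomp_spec p q (pcomp p q).
Proof.
rewrite /pcomp; case: {-}_ / idP => e; constructor => //; first exact/eqP.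
by move/eqP.
Qed.

Lemma qpath_eq (p q : qpath) : psrc p = psrc q -> parr p = parr q -> p = q.
Proof.
move=> e1 e2; apply: val_inj => /=.
by rewrite [pval p]surjective_pairing [pval q]surjective_pairing; congr pair.
Qed.

Lemma pend_cat (p q r : qpath) : pend p = psrc q -> psrc r = psrc p ->
  parr r = parr p ++ parr q -> pend r = pend q.
Proof.
by rewrite /pend /walk_end => e -> ->; rewrite foldl_cat -e.
Qed.

Lemma pcompA p q r :
  obind (pcomp p) (pcomp q r) = obind (pcomp^~ r) (pcomp p q).
Proof.
case: (pcompP q r) => [s e1 e2 e3|n1]; case: (pcompP p q) => [t f1 f2 f3|n2] //=.
- case: (pcompP p s) => [u g1 g2 g3|]; last by rewrite e2 f1.
  case: (pcompP t r) => [v h1 h2 h3|]; last by rewrite (pend_cat f1 f2 f3) e1.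
  by congr Some; apply: qpath_eq; rewrite ?g2 ?h2 ?g3 ?h3 ?e3 ?f3 ?f2 ?catA.
- by case: (pcompP p s) => // u; rewrite e2.
- by case: (pcompP t r) => // u; rewrite (pend_cat f1 f2 f3).
Qed.

End Paths.

Section PathAlgebra.
Variables (K : fieldType) (Q : quiver).

Definition path_alg : Type := {malg K[qpath Q]}.
HB.instance Definition _ := GRing.Lmodule.copy path_alg {malg K[qpath Q]}.

Implicit Types (x y z : path_alg) (p q r : qpath Q).

Definition pathE p : path_alg := << 1 *g p >>.
Definition opathE (o : option (qpath Q)) : path_alg := oapp pathE 0 o.
Definition vertE (v : qvert Q) : path_alg := pathE (ptriv v).
Definition pcoef p x : K := mcoeff p x.
Definition psupp x : {fset qpath Q} := msupp x.

Fact kq_mul_key : unit. Proof. exact: tt. Qed.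
Definition kq_mul : path_alg -> path_alg -> path_alg :=
  locked_with kq_mul_key (fun x y =>
    \sum_(p <- psupp x) \sum_(q <- psupp y)
       (pcoef p x * pcoef q y) *: opathE (pcomp p q)).

Lemma kq_mulE x y : kq_mul x y =
  \sum_(p <- psupp x) \sum_(q <- psupp y)
     (pcoef p x * pcoef q y) *: opathE (pcomp p q).
Proof. by rewrite /kq_mul unlock. Qed.

Definition kq_one : path_alg := \sum_(v : qvert Q) vertE v.

Lemma pcoefD p x y : pcoef p (x + y) = pcoef p x + pcoef p y.
Proof. exact: mcoeffD. Qed.

Lemma pcoefZ p c x : pcoef p (c *: x) = c * pcoef p x.
Proof. exact: mcoeffZ. Qed.

Lemma pcoef_pathE p q : pcoef q (pathE p) = (p == q)%:R.
Proof. exact: mcoeffU. Qed.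

Lemma path_algP x y : (forall p, pcoef p x = pcoef p y) -> x = y.
Proof. by move=> h; apply/malgP. Qed.

Lemma pcoef_out p x : p \notin psupp x -> pcoef p x = 0.
Proof. exact: mcoeff_outdom. Qed.

Lemma path_algE x : x = \sum_(p <- psupp x) pcoef p x *: pathE p.
Proof.
rewrite [LHS]monalgE; apply: eq_bigr => p _; apply: path_algP => q.
rewrite pcoefZ pcoef_pathE mulr_natr; exact: mcoeffU.
Qed.

Lemma kq_mulw (d1 d2 : {fset qpath Q}) x y :
  fsubset (psupp x) d1 -> fsubset (psupp y) d2 ->
  kq_mul x y = \sum_(p <- d1) \sum_(q <- d2)
     (pcoef p x * pcoef q y) *: opathE (pcomp p q).
Proof.
move=> l1 l2; rewrite kq_mulE (big_fset_incl _ l1) /=.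
  apply: eq_bigr => p _; apply: big_fset_incl => // q _ /pcoef_out ->.
  by rewrite mulr0 scale0r.
move=> p _ /pcoef_out px; rewrite big1 // => q _.
by rewrite px mul0r scale0r.
Qed.

Lemma kq_mulDl : left_distributive kq_mul +%R.
Proof.
move=> x y z; pose d := fsetU (fsetU (psupp x) (psupp y)) (psupp (x + y)).
have lx : fsubset (psupp x) d.
  by apply/fsubsetP => p h; rewrite !inE h.
have ly : fsubset (psupp y) d.
  by apply/fsubsetP => p h; rewrite !inE h orbT.
have lxy : fsubset (psupp (x + y)) d.
  by apply/fsubsetP => p h; rewrite !inE h !orbT.
rewrite (kq_mulw lx (fsubset_refl _)) (kq_mulw ly (fsubset_refl _)).
rewrite (kq_mulw lxy (fsubset_refl _)) -big_split; apply: eq_bigr => p _ /=.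
rewrite -big_split; apply: eq_bigr => q _ /=.
by rewrite pcoefD mulrDl scalerDl.
Qed.

Lemma kq_mulDr : right_distributive kq_mul +%R.
Proof.
move=> z x y; pose d := fsetU (fsetU (psupp x) (psupp y)) (psupp (x + y)).
have lx : fsubset (psupp x) d.
  by apply/fsubsetP => p h; rewrite !inE h.
have ly : fsubset (psupp y) d.
  by apply/fsubsetP => p h; rewrite !inE h orbT.
have lxy : fsubset (psupp (x + y)) d.
  by apply/fsubsetP => p h; rewrite !inE h !orbT.
rewrite (kq_mulw (fsubset_refl _) lx) (kq_mulw (fsubset_refl _) ly).
rewrite (kq_mulw (fsubset_refl _) lxy) -big_split; apply: eq_bigr => p _ /=.
rewrite -big_split; apply: eq_bigr => q _ /=.
by rewrite pcoefD mulrDr scalerDl.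
Qed.

Lemma psuppZ_le c x : fsubset (psupp (c *: x)) (psupp x).
Proof. exact: msuppZ_le. Qed.

Lemma kq_mulZl c x y : c *: kq_mul x y = kq_mul (c *: x) y.
Proof.
rewrite (kq_mulw (psuppZ_le c x) (fsubset_refl _)) kq_mulE scaler_sumr.
apply: eq_bigr => p _; rewrite scaler_sumr; apply: eq_bigr => q _.
by rewrite pcoefZ scalerA mulrA.
Qed.

Lemma kq_mulZr c x y : c *: kq_mul x y = kq_mul x (c *: y).
Proof.
rewrite (kq_mulw (fsubset_refl _) (psuppZ_le c y)) kq_mulE scaler_sumr.
apply: eq_bigr => p _; rewrite scaler_sumr; apply: eq_bigr => q _.
by rewrite pcoefZ scalerA mulrCA.
Qed.

Lemma kq_mul0l x : kq_mul 0 x = 0.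
Proof. by rewrite -[X in kq_mul X _](scale0r (0 : path_alg)) -kq_mulZl scale0r. Qed.

Lemma kq_mul0r x : kq_mul x 0 = 0.
Proof. by rewrite -[X in kq_mul _ X](scale0r (0 : path_alg)) -kq_mulZr scale0r. Qed.

Lemma kq_mul_suml (I : Type) (s : seq I) (F : I -> path_alg) y :
  kq_mul (\sum_(i <- s) F i) y = \sum_(i <- s) kq_mul (F i) y.
Proof. exact: (big_morph (kq_mul^~ y) (fun a b => kq_mulDl a b y) (kq_mul0l y)). Qed.

Lemma kq_mul_sumr (I : Type) (s : seq I) (F : I -> path_alg) x :
  kq_mul x (\sum_(i <- s) F i) = \sum_(i <- s) kq_mul x (F i).
Proof. exact: (big_morph (kq_mul x) (kq_mulDr x) (kq_mul0r x)). Qed.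

Lemma kq_mul_path p q : kq_mul (pathE p) (pathE q) = opathE (pcomp p q).
Proof.
have l r : fsubset (psupp (pathE r)) [fset r]%fset by exact: msuppU_le.
rewrite (kq_mulw (l p) (l q)) !big_seq_fset1 !pcoef_pathE !eqxx.
by rewrite mulr1 scale1r.
Qed.

Lemma kq_ind2 (P : path_alg -> Prop) :
  (forall x y, P x -> P y -> P (x + y)) -> (forall c x, P x -> P (c *: x)) ->
  P 0 -> (forall p, P (pathE p)) -> forall x, P x.
Proof.
move=> hD hZ h0 hp x; rewrite [x]path_algE.
by elim/big_ind: _ => // p _; apply: hZ.
Qed.

Lemma kq_mulA : associative kq_mul.
Proof.
have hx y z : (forall p, kq_mul (pathE p) (kq_mul y z) =
                         kq_mul (kq_mul (pathE p) y) z) ->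
    forall x, kq_mul x (kq_mul y z) = kq_mul (kq_mul x y) z.
  move=> h; apply: kq_ind2 => // [a b ha hb|c a ha|].
  - by rewrite !kq_mulDl ha hb.
  - by rewrite -!kq_mulZl ha.
  - by rewrite !kq_mul0l.
have hy x z : (forall q, kq_mul x (kq_mul (pathE q) z) =
                         kq_mul (kq_mul x (pathE q)) z) ->
    forall y, kq_mul x (kq_mul y z) = kq_mul (kq_mul x y) z.
  move=> h; apply: kq_ind2 => // [a b ha hb|c a ha|].
  - by rewrite !(kq_mulDl, kq_mulDr) ha hb.
  - have e : c *: kq_mul x (kq_mul a z) = c *: kq_mul (kq_mul x a) z by rewrite ha.
    by rewrite (kq_mulZr c x) (kq_mulZl c a) (kq_mulZl c) (kq_mulZr c x a) in e.
  - by rewrite kq_mul0l !kq_mul0r kq_mul0l.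
have hz x y : (forall r, kq_mul x (kq_mul y (pathE r)) =
                         kq_mul (kq_mul x y) (pathE r)) ->
    forall z, kq_mul x (kq_mul y z) = kq_mul (kq_mul x y) z.
  move=> h; apply: kq_ind2 => // [a b ha hb|c a ha|].
  - by rewrite !kq_mulDr ha hb.
  - by rewrite -!kq_mulZr ha.
  - by rewrite !kq_mul0r.
move=> x y z; apply: (hx) => p; apply: (hy) => q; apply: (hz) => r.
have e1 o : kq_mul (pathE p) (opathE o) = opathE (obind (pcomp p) o).
  by case: o => [s|]; [exact: kq_mul_path | exact: kq_mul0r].
have e2 o : kq_mul (opathE o) (pathE r) = opathE (obind ((@pcomp Q)^~ r) o).
  by case: o => [s|]; [exact: kq_mul_path | exact: kq_mul0l].
apply: etrans (congr1 (kq_mul (pathE p)) (kq_mul_path q r)) _.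
apply: etrans _ (congr1 (kq_mul^~ (pathE r)) (esym (kq_mul_path p q))).
exact: etrans (e1 _) (etrans (congr1 opathE (pcompA p q r)) (esym (e2 _))).
Qed.

Lemma pcomp_trivl v p : opathE (pcomp (ptriv v) p) = if v == psrc p then pathE p else 0.
Proof.
case: pcompP => [r /= e1 e2 e3|/= /eqP n]; last by rewrite (negPf n).
rewrite -e1 eqxx; congr pathE; apply: qpath_eq => //.
by rewrite e2 -e1.
Qed.

Lemma pcomp_trivr v p : opathE (pcomp p (ptriv v)) = if v == pend p then pathE p else 0.
Proof.
case: pcompP => [r /= e1 e2 e3|/= /eqP n]; last by rewrite eq_sym (negPf n).
by rewrite e1 eqxx; congr pathE; apply: qpath_eq => //; rewrite e3 cats0.
Qed.

Lemma kq_mul1 : left_id kq_one kq_mul.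
Proof.
move=> x; elim/kq_ind2: x => [a b ha hb|c a ha||p].
- by rewrite kq_mulDr ha hb.
- by rewrite -kq_mulZr ha.
- by rewrite kq_mul0r.
rewrite kq_mul_suml (bigD1 (psrc p)) //= kq_mul_path pcomp_trivl eqxx.
rewrite big1 ?addr0 // => v n.
by rewrite kq_mul_path pcomp_trivl (negPf n).
Qed.

Lemma kq_mulr1 : right_id kq_one kq_mul.
Proof.
move=> x; elim/kq_ind2: x => [a b ha hb|c a ha||p].
- by rewrite kq_mulDl ha hb.
- by rewrite -kq_mulZl ha.
- by rewrite kq_mul0l.
rewrite kq_mul_sumr (bigD1 (pend p)) //= kq_mul_path pcomp_trivr eqxx.
rewrite big1 ?addr0 // => v n.
by rewrite kq_mul_path pcomp_trivr (negPf n).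
Qed.

Lemma kq_one_neq0 : kq_one != 0.
Proof.
have /card_gt0P [v _] := qvert_nonempty Q.
apply/eqP => e.
have: kq_mul kq_one (vertE v) = 0 by rewrite e kq_mul0l.
rewrite kq_mul1 => /(congr1 (pcoef (ptriv v))) /eqP.
rewrite pcoef_pathE eqxx.
have -> : pcoef (ptriv v) 0 = 0 by exact: mcoeff0.
by rewrite oner_eq0.
Qed.

HB.instance Definition _ := GRing.Zmodule_isNzRing.Build path_alg
  kq_mulA kq_mul1 kq_mulr1 kq_mulDl kq_mulDr kq_one_neq0.
HB.instance Definition _ := GRing.Lmodule_isLalgebra.Build K path_alg kq_mulZl.
HB.instance Definition _ := GRing.Lalgebra_isAlgebra.Build K path_alg kq_mulZr.

(* The [m]-th power of the arrow ideal. *)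
Definition in_arrow_ideal_pow (m : nat) (x : path_alg) : Prop :=
  forall p, p \in psupp x -> (m <= plen p)%N.

(* For a linear multiplicative [pi], the set of [x] with [pi x = 0] is the
   ideal [I] of relations. *)
Definition bound_quiver_algebra (A : falgType K)
    (pi : {lrmorphism path_alg -> A}) : Prop :=
  [/\ forall a : A, exists x, pi x = a,
      forall x, pi x = 0 -> in_arrow_ideal_pow 2 x
    & exists2 m : nat, (2 <= m)%N &
        forall x, in_arrow_ideal_pow m x -> pi x = 0].

End PathAlgebra.

(** * Group actions and skew group algebras *)

Record alg_action (gT : finGroupType) (K : fieldType) (A : algType K) :=
  AlgAction {
    aact :> gT -> {lrmorphism A -> A};
    aact1 : forall a, aact 1%g a = a;
    aactM : forall g h a, aact (g * h)%g a = aact g (aact h a) }.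

(* [vact g i] is the vertex to which [g] sends [i]. *)
Definition permutes_vertices (gT : finGroupType) (K : fieldType) (Q : quiver)
    (actQ : alg_action gT (path_alg K Q)) (vact : gT -> qvert Q -> qvert Q) :=
  forall g i, actQ g (vertE K i) = vertE K (vact g i).

Definition vstab (gT : finGroupType) (Q : quiver)
    (vact : gT -> qvert Q -> qvert Q) (i : qvert Q) : {set gT} :=
  [set g | vact g i == i].

Definition vorbit (gT : finGroupType) (Q : quiver)
    (vact : gT -> qvert Q -> qvert Q) (i : qvert Q) : {set qvert Q} :=
  [set vact g i | g in [set: gT]].

(* There are exactly [m] irreducible representations of [gT] over [K] up to
   isomorphism. *)
Definition num_irreducibles (K : fieldType) (gT : finGroupType) (m : nat) :=
  exists (d : 'I_m -> nat)
         (rho : forall i, mx_representation K [set: gT] (d i)),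
    [/\ forall i, mx_irreducible (rho i),
        forall i j, mx_rsim (rho i) (rho j) -> i = j
      & forall (e : nat) (sigma : mx_representation K [set: gT] e),
          mx_irreducible sigma -> exists i, mx_rsim sigma (rho i)].

(* The function [s] stands for the sum of the [s g (x) g].  The action is a
   parameter of the type because it determines the multiplication. *)
Definition skew_alg (gT : finGroupType) (K : fieldType) (A : falgType K)
  (act : alg_action gT A) : Type := {ffun gT -> A}.
Arguments skew_alg {gT K A} act.

Section SkewGroupAlgebra.
Variables (gT : finGroupType) (K : fieldType) (A : falgType K).
Variable act : alg_action gT A.

Local Notation skew_alg := (skew_alg act).

HB.instance Definition _ := Vector.copy skew_alg {ffun gT -> A}.

Implicit Types s t : skew_alg.

Definition skew_elt (a : A) (g : gT) : skew_alg :=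
  [ffun h => if h == g then a else 0].

Definition skew_mul s t : skew_alg :=
  [ffun k => \sum_(g : gT) s g * act g (t (g^-1 * k)%g)].

Definition skew_one : skew_alg := skew_elt 1 1%g.

Lemma aactK g : cancel (act g) (act g^-1%g).
Proof. by move=> a; rewrite -aactM mulVg aact1. Qed.

Lemma aactVK g : cancel (act g^-1%g) (act g).
Proof. by move=> a; rewrite -aactM mulgV aact1. Qed.

Lemma skew_mulA : associative skew_mul.
Proof.
move=> s t u; apply/ffunP => k; rewrite !ffunE.
under eq_bigr => g _ do rewrite ffunE raddf_sum mulr_sumr.
under [RHS]eq_bigr => g _ do rewrite ffunE mulr_suml.
rewrite [RHS]exchange_big /=; apply: eq_bigr => g _.
rewrite [RHS](reindex_inj (mulgI g)) /=; apply: eq_bigr => h _.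
by rewrite mulKg aactM rmorphM /= mulrA invMg mulgA.
Qed.

Lemma skew_mul1 : left_id skew_one skew_mul.
Proof.
move=> s; apply/ffunP => k; rewrite ffunE (bigD1 1%g) //= big1 => [|g n].
  by rewrite ffunE eqxx mul1r aact1 invg1 mul1g addr0.
by rewrite ffunE (negPf n) mul0r.
Qed.

Lemma skew_mulr1 : right_id skew_one skew_mul.
Proof.
move=> s; apply/ffunP => k; rewrite ffunE (bigD1 k) //= big1 => [|g n].
  by rewrite ffunE mulVg eqxx rmorph1 mulr1 addr0.
by rewrite ffunE -eq_mulVg1 (negPf n) raddf0 mulr0.
Qed.

Lemma skew_mulDl : left_distributive skew_mul +%R.
Proof.
move=> s t u; apply/ffunP => k; rewrite !ffunE -big_split.
by apply: eq_bigr => g _; rewrite ffunE mulrDl.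
Qed.

Lemma skew_mulDr : right_distributive skew_mul +%R.
Proof.
move=> s t u; apply/ffunP => k; rewrite !ffunE -big_split.
by apply: eq_bigr => g _; rewrite ffunE raddfD mulrDr.
Qed.

Lemma skew_one_neq0 : skew_one != 0.
Proof.
apply/eqP => /ffunP/(_ 1%g)/eqP; rewrite !ffunE eqxx.
by rewrite oner_eq0.
Qed.

Lemma skew_mulZl (c : K) s t : c *: skew_mul s t = skew_mul (c *: s) t.
Proof.
apply/ffunP => k; rewrite !ffunE scaler_sumr.
by apply: eq_bigr => g _; rewrite ffunE scalerAl.
Qed.

Lemma skew_mulZr (c : K) s t : c *: skew_mul s t = skew_mul s (c *: t).
Proof.
apply/ffunP => k; rewrite !ffunE scaler_sumr.
by apply: eq_bigr => g _; rewrite ffunE linearZ /= scalerAr.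
Qed.

HB.instance Definition _ := GRing.Zmodule_isNzRing.Build skew_alg
  skew_mulA skew_mul1 skew_mulr1 skew_mulDl skew_mulDr skew_one_neq0.
HB.instance Definition _ := GRing.Lmodule_isLalgebra.Build K skew_alg skew_mulZl.
HB.instance Definition _ := GRing.Lalgebra_isAlgebra.Build K skew_alg skew_mulZr.
HB.instance Definition _ := Algebra_isFalgebra.Build K skew_alg.

Lemma skew_eltM a b g h :
  skew_elt a g * skew_elt b h = skew_elt (a * act g b) (g * h)%g.
Proof.
apply/ffunP => k; rewrite !ffunE (bigD1 g) //= big1 => [|g' n].
  rewrite !ffunE eqxx addr0 -(inj_eq (mulgI g)) mulKVg.
  by case: eqP => // _; rewrite raddf0 mulr0.
by rewrite ffunE (negPf n) mul0r.
Qed.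

End SkewGroupAlgebra.

Arguments skew_elt {gT K A} act a g.

(** * Finite-dimensional modules *)

Section Lfun.
Variables (K : fieldType).

(* The linear map [l |-> (f l, g l)]. *)
Section Pair.
Variables (T M N : vectType K) (f : 'Hom(T, M)) (g : 'Hom(T, N)).
Definition lpair_fun (l : T) : M * N := (f l, g l).
Fact lpair_is_linear : linear lpair_fun.
Proof. by move=> c x y; rewrite /lpair_fun !linearP. Qed.
HB.instance Definition _ := GRing.isLinear.Build K T (M * N)%type _ lpair_fun
  lpair_is_linear.
Definition lpair : 'Hom(T, (M * N)%type) := linfun lpair_fun.
Lemma lpairE l : lpair l = (f l, g l). Proof. exact: lfunE. Qed.
End Pair.

Section Projections.
Variables (M N : vectType K).
Definition lfst : 'Hom((M * N)%type, M) := linfun (@fst M N).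
Definition lsnd : 'Hom((M * N)%type, N) := linfun (@snd M N).
Lemma lfstE x : lfst x = x.1. Proof. exact: lfunE. Qed.
Lemma lsndE x : lsnd x = x.2. Proof. exact: lfunE. Qed.
End Projections.

(* The quotient of [V] by [U], realized on the complement [U^C]. *)
Section Quotient.
Variables (V : vectType K) (U : {vspace V}).
Definition quot_sp : vectType K := subvs_of (U^C)%VS.
Definition quot_proj : 'Hom(V, quot_sp) :=
  (linfun (vsproj (U^C)%VS) \o daddv_pi (U^C)%VS U)%VF.
Definition quot_lift : 'Hom(quot_sp, V) := linfun (@vsval _ _ (U^C)%VS).

Lemma quot_liftK : cancel quot_lift quot_proj.
Proof.
move=> w; rewrite /quot_lift /quot_proj comp_lfunE !lfunE /=.
by rewrite daddv_pi_id ?subvsP ?vsvalK // capvC capv_compl.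
Qed.

Lemma quot_projK v : v - quot_lift (quot_proj v) \in U.
Proof.
rewrite /quot_lift /quot_proj comp_lfunE !lfunE /= vsprojK ?memv_pi //.
have := @daddv_pi_add _ _ (U^C)%VS U v.
rewrite capvC capv_compl addvC addv_complf memvf => /(_ erefl isT) e.
by rewrite -{1}e addrC addKr memv_pi.
Qed.

Lemma quot_proj_eq0 v : (quot_proj v == 0) = (v \in U).
Proof.
apply/eqP/idP => [e|vU]; first by have := quot_projK v; rewrite e linear0 subr0.
apply: (can_inj quot_liftK); rewrite linear0; apply/eqP.
rewrite -memv0 -(capv_compl U) memv_cap; apply/andP; split.
  rewrite -[X in X \in _](subKr v) memvB ?quot_projK //.
by rewrite /quot_lift lfunE subvsP.
Qed.
End Quotient.

(* The linear map [x |-> (h |-> f (x h))]. *)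
Section FfunMap.
Variables (I : finType) (V W : vectType K) (f : 'Hom(V, W)).
Definition ffmap_fun (x : {ffun I -> V}) : {ffun I -> W} := [ffun h => f (x h)].
Fact ffmap_is_linear : linear ffmap_fun.
Proof. by move=> c x y; apply/ffunP => h; rewrite !ffunE linearP. Qed.
HB.instance Definition _ := GRing.isLinear.Build K {ffun I -> V} {ffun I -> W} _
  ffmap_fun ffmap_is_linear.
Definition ffmap : 'Hom({ffun I -> V}, {ffun I -> W}) := linfun ffmap_fun.
Lemma ffmapE x h : ffmap x h = f (x h).
Proof. by rewrite lfunE ffunE. Qed.
End FfunMap.

End Lfun.

Arguments quot_proj {K V} U.
Arguments quot_lift {K V} U.
Arguments ffmap {K} I {V W} f.

(* A left [A]-module that is finite-dimensional over [K].  Since [A] is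
   finite-dimensional, these are exactly the finitely presented modules. *)
Record amod (K : fieldType) (A : falgType K) := AMod {
  amod_sort :> vectType K;
  amod_act : A -> 'End(amod_sort);
  amod_actP : linear amod_act;
  amod_act1 : amod_act 1 = \1%VF;
  amod_actM : forall a b, amod_act (a * b) = (amod_act a \o amod_act b)%VF }.

HB.instance Definition _ (K : fieldType) (A : falgType K) (M : amod A) :=
  GRing.isLinear.Build K A 'End(M) _ (amod_act M) (@amod_actP K A M).

Section Modules.
Variables (K : fieldType) (A : falgType K).
Implicit Types M N : amod A.

Definition is_hom M N (f : 'Hom(M, N)) : Prop :=
  forall a x, f (amod_act M a x) = amod_act N a (f x).

Definition hom_iso M N (f : 'Hom(M, N)) : Prop :=
  is_hom f /\ exists2 g : 'Hom(N, M), is_hom g & cancel f g /\ cancel g f.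

Definition isomorphic M N : Prop := exists f : 'Hom(M, N), hom_iso f.

Lemma amod_actMx M a b x :
  amod_act M (a * b) x = amod_act M a (amod_act M b x).
Proof. by rewrite amod_actM comp_lfunE. Qed.

(* A ring is local if it is nonzero and the sum of two non-units is never a
   unit; here for the ring of endomorphisms of [M]. *)
Definition local_end M : Prop :=
  (\1%VF != 0 :> 'End(M)) /\
  forall f g : 'End(M), is_hom f -> is_hom g ->
    @hom_iso M M (f + g) -> @hom_iso M M f \/ @hom_iso M M g.

Definition is_submod M (U : {vspace M}) : Prop :=
  forall a x, x \in U -> amod_act M a x \in U.

Definition is_simple_submod M (S : {vspace M}) : Prop :=
  [/\ is_submod S, S != 0%VS
    & forall U : {vspace M}, is_submod U -> (U <= S)%VS -> U = 0%VS \/ U = S].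

(* [M] is a finite direct sum of simple modules. *)
Definition semisimple M : Prop :=
  exists (m : nat) (S : 'I_m -> {vspace M}),
    [/\ forall i, is_simple_submod (S i), directv (\sum_i S i)
      & (\sum_i S i)%VS = fullv].

Section DirectSum.
Variables M N : amod A.

Definition dsum_act (a : A) : 'End((M * N)%type) :=
  lpair (amod_act M a \o lfst M N)%VF (amod_act N a \o lsnd M N)%VF.

Lemma dsum_actE a (x : (M * N)%type) :
  dsum_act a x = (amod_act M a x.1, amod_act N a x.2).
Proof. by rewrite lpairE !comp_lfunE lfstE lsndE. Qed.

Fact dsum_actP : linear dsum_act.
Proof.
move=> c a b; apply/lfunP => x.
by rewrite add_lfunE scale_lfunE !dsum_actE !amod_actP !(add_lfunE, scale_lfunE).
Qed.

Fact dsum_act1 : dsum_act 1 = \1%VF.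
Proof. by apply/lfunP => -[x y]; rewrite dsum_actE !amod_act1 !id_lfunE. Qed.

Fact dsum_actM a b : dsum_act (a * b) = (dsum_act a \o dsum_act b)%VF.
Proof.
by apply/lfunP => x; rewrite comp_lfunE !dsum_actE !amod_actM !comp_lfunE.
Qed.

Definition dsum : amod A := AMod dsum_actP dsum_act1 dsum_actM.
End DirectSum.

Section QuotientModule.
Variables (M : amod A) (U : {vspace M}) (subU : is_submod U).

Definition quot_act (a : A) : 'End(quot_sp U) :=
  (quot_proj U \o amod_act M a \o quot_lift U)%VF.

Lemma quot_actE a w :
  quot_act a w = quot_proj U (amod_act M a (quot_lift U w)).
Proof. by rewrite /quot_act 2!comp_lfunE. Qed.

Lemma quot_act_proj a x :
  quot_act a (quot_proj U x) = quot_proj U (amod_act M a x).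
Proof.
rewrite quot_actE; apply/eqP; rewrite eq_sym -subr_eq0 -!linearB /=.
by rewrite quot_proj_eq0 subU ?quot_projK.
Qed.

Fact quot_actP : linear quot_act.
Proof.
move=> c a b; apply/lfunP => x.
by rewrite add_lfunE scale_lfunE !quot_actE amod_actP add_lfunE scale_lfunE linearP.
Qed.

Fact quot_act1 : quot_act 1 = \1%VF.
Proof.
by apply/lfunP => x; rewrite quot_actE amod_act1 !id_lfunE quot_liftK.
Qed.

Fact quot_actM a b : quot_act (a * b) = (quot_act a \o quot_act b)%VF.
Proof.
apply/lfunP => x; rewrite -(quot_liftK x) comp_lfunE !quot_act_proj.
by rewrite amod_actM comp_lfunE.
Qed.

Definition quot_mod : amod A := AMod quot_actP quot_act1 quot_actM.

Lemma quot_proj_hom : @is_hom M quot_mod (quot_proj U).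
Proof. by move=> a x; rewrite /= quot_act_proj. Qed.
End QuotientModule.

Lemma hom_comp (M N P : amod A) (f : 'Hom(N, P)) (g : 'Hom(M, N)) :
  is_hom f -> is_hom g -> is_hom (f \o g)%VF.
Proof. by move=> hf hg a x; rewrite !comp_lfunE hg hf. Qed.

Lemma lpair_hom (T M N : amod A) (f : 'Hom(T, M)) (g : 'Hom(T, N)) :
  is_hom f -> is_hom g -> @is_hom T (dsum M N) (lpair f g).
Proof. by move=> hf hg a x; rewrite /= dsum_actE !lpairE /= hf hg. Qed.

Lemma hom_opp (M N : amod A) (f : 'Hom(M, N)) : is_hom f -> is_hom (- f).
Proof. by move=> hf a x; rewrite !opp_lfunE hf linearN. Qed.

Lemma hom0 (M N : amod A) : @is_hom M N 0.
Proof. by move=> a x; rewrite !zero_lfunE linear0. Qed.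

Lemma limg_submod (M N : amod A) (f : 'Hom(M, N)) :
  is_hom f -> is_submod (limg f).
Proof.
move=> hf a y /memv_imgP [x _ ->]; rewrite -hf.
by apply: memv_img; exact: memvf.
Qed.

End Modules.

(** * Pointed modules *)

Record pmod (K : fieldType) (A : falgType K) (theta : amod A) := PMod {
  pmod_mod :> amod A;
  pt : 'Hom(theta, pmod_mod);
  pt_hom : is_hom pt }.

Section PointedModules.
Variables (K : fieldType) (A : falgType K) (theta : amod A).
Implicit Types M N : pmod theta.

Definition is_phom M N (f : 'Hom(M, N)) : Prop :=
  @is_hom K A M N f /\ forall l, f (pt M l) = pt N l.

Definition phom_exists M N : Prop := exists f : 'Hom(M, N), is_phom f.

Definition theta_isomorphic M N : Prop :=
  exists f : 'Hom(M, N), is_phom f /\ @hom_iso K A M N f.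

Definition pdsum M N : pmod theta :=
  @PMod K A theta (dsum M N) (lpair (pt M) (pt N))
    (lpair_hom (@pt_hom _ _ _ M) (@pt_hom _ _ _ N)).

Section Pushout.
Variables M N : pmod theta.

(* The subspace of all [(pt M l, - pt N l)]. *)
Definition amalg_rel : {vspace (dsum M N)} := limg (lpair (pt M) (- pt N)).

Lemma amalg_rel_submod : is_submod amalg_rel.
Proof.
exact: limg_submod (lpair_hom (@pt_hom _ _ _ M) (hom_opp (@pt_hom _ _ _ N))).
Qed.

Definition amalg : amod A := quot_mod amalg_rel_submod.

Definition amalg_pt : 'Hom(theta, amalg) :=
  (quot_proj amalg_rel \o lpair (pt M) 0)%VF.

Lemma amalg_pt_hom : is_hom amalg_pt.
Proof.
exact: hom_comp (@quot_proj_hom _ _ _ _ amalg_rel_submod)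
  (lpair_hom (@pt_hom _ _ _ M) (@hom0 _ _ theta N)).
Qed.

Definition ppushout : pmod theta := PMod amalg_pt_hom.
End Pushout.

(** ** The poset of classes *)

Definition pequiv M N : Prop := phom_exists M N /\ phom_exists N M.

Definition pclass : Type :=
  {X : pmod theta -> Prop | exists M, X = pequiv M}.

Definition pcls M : pclass := exist _ (pequiv M) (ex_intro _ M erefl).

Definition pclass_le (X Y : pclass) : Prop :=
  exists M N, [/\ X = pcls M, Y = pcls N & phom_exists N M].

Definition pclass_lt (X Y : pclass) : Prop := pclass_le X Y /\ X <> Y.

Definition pclass_incomparable (X Y : pclass) : Prop :=
  ~ pclass_le X Y /\ ~ pclass_le Y X.

Definition wide (L : pclass -> Prop) : Prop :=
  forall X Y, L X -> L Y -> pclass_lt X Y ->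
  exists M N,
    [/\ L (pcls M) /\ L (pcls N),
        pclass_incomparable (pcls M) (pcls N),
        pclass_lt X (pcls M) /\ pclass_lt (pcls M) Y,
        pclass_lt X (pcls N) /\ pclass_lt (pcls N) Y
      & [/\ pclass_lt X (pcls (ppushout M N)),
            pclass_lt (pcls (ppushout M N)) (pcls (pdsum M N))
          & pclass_lt (pcls (pdsum M N)) Y]].

Definition pfamily_classes (I : Type) (M : I -> pmod theta) : pclass -> Prop :=
  fun X => exists p, X = pcls (M p).

(** ** Dense chains *)

Definition rational_chain (d : Order.disp_t) (C : porderType d) : Prop :=
  exists2 f : C -> rat, bijective f & forall x y : C, (f x <= f y) = (x <= y)%O.

Definition dense_chain (d : Order.disp_t) (C : porderType d)
    (M : C -> pmod theta) : Prop :=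
  [/\ rational_chain C,
      forall q, local_end (M q) /\ pt (M q) != 0,
      forall q q', (q < q')%O -> phom_exists (M q) (M q')
    & forall q q', q != q' -> ~ theta_isomorphic (M q) (M q')].

Definition independent_pair (d1 d2 : Order.disp_t)
    (C1 : porderType d1) (C2 : porderType d2)
    (M : C1 -> pmod theta) (N : C2 -> pmod theta) : Prop :=
  [/\ dense_chain M, dense_chain N,
      forall q t, local_end (ppushout (M q) (N t))
    & forall q q' t t', q != q' -> t != t' ->
        ~ theta_isomorphic (ppushout (M q) (N t)) (ppushout (M q') (N t)) /\
        ~ theta_isomorphic (ppushout (M q) (N t)) (ppushout (M q) (N t'))].

End PointedModules.

(** * Twisting and push-down *)

Section Twist.
Variables (gT : finGroupType) (K : fieldType) (A : falgType K).
Variable act : alg_action gT A.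

Section TwistOne.
Variables (g : gT) (M : amod A).

Definition twist_act (a : A) : 'End(M) := amod_act M (act g^-1%g a).

Fact twist_actP : linear twist_act.
Proof. by move=> c a b; rewrite /twist_act linearP amod_actP. Qed.

Fact twist_act1 : twist_act 1 = \1%VF.
Proof. by rewrite /twist_act rmorph1 amod_act1. Qed.

Fact twist_actM a b : twist_act (a * b) = (twist_act a \o twist_act b)%VF.
Proof. by rewrite /twist_act rmorphM amod_actM. Qed.

Definition twist : amod A := AMod twist_actP twist_act1 twist_actM.
End TwistOne.

(* [full_stab M] says that [G_M = G]. *)
Definition mod_stab (M : amod A) : gT -> Prop := fun g => isomorphic (twist g M) M.
Definition full_stab (M : amod A) : Prop := forall g, mod_stab M g.

Definition non_symmetric (theta : amod A) (d1 d2 : Order.disp_t)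
    (C1 : porderType d1) (C2 : porderType d2)
    (M : C1 -> pmod theta) (N : C2 -> pmod theta) : Prop :=
  forall g : gT, g != 1%g -> forall (q1 q2 : C1) (t1 t2 : C2),
    [/\ ~ isomorphic (twist g (M q1)) (M q2),
        ~ isomorphic (twist g (N t1)) (N t2)
      & ~ isomorphic (twist g (ppushout (M q1) (N t1)))
                     (ppushout (M q2) (N t2))].

(** ** The functor *)

(* The tensor product of the skew group algebra with [M] over [A] is the direct
   sum over [h] of the spaces [(1 (x) h) (x) M]; the function [x] stands for
   the sum of the [(1 (x) h) (x) x h].  The formula for the action comes from
   [(a (x) g)(1 (x) h) = (1 (x) gh)((gh)^-1(a) (x) 1)]. *)
Section PushDown.
Variable M : amod A.

Definition pushdown_act_fun (s : skew_alg act) (x : {ffun gT -> M}) :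
    {ffun gT -> M} :=
  [ffun k => \sum_(g : gT) amod_act M (act k^-1%g (s g)) (x (g^-1 * k)%g)].

Fact pushdown_act_is_linear s : linear (pushdown_act_fun s).
Proof.
move=> c x y; apply/ffunP => k; rewrite !ffunE scaler_sumr -big_split.
by apply: eq_bigr => g _; rewrite !ffunE linearP.
Qed.
HB.instance Definition _ s := GRing.isLinear.Build K {ffun gT -> M}
  {ffun gT -> M} _ (pushdown_act_fun s) (pushdown_act_is_linear s).

Definition pushdown_act (s : skew_alg act) : 'End({ffun gT -> M}) :=
  linfun (pushdown_act_fun s).

Lemma pushdown_actE s x k : pushdown_act s x k =
  \sum_(g : gT) amod_act M (act k^-1%g (s g)) (x (g^-1 * k)%g).
Proof. by rewrite lfunE ffunE. Qed.

Fact pushdown_actP : linear pushdown_act.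
Proof.
move=> c s t; apply/lfunP => x; apply/ffunP => k.
rewrite add_lfunE scale_lfunE !ffunE !pushdown_actE scaler_sumr -big_split.
apply: eq_bigr => g _.
by rewrite !ffunE linearP amod_actP add_lfunE scale_lfunE.
Qed.

Fact pushdown_act1 : pushdown_act 1 = \1%VF.
Proof.
apply/lfunP => x; apply/ffunP => k; rewrite id_lfunE pushdown_actE.
rewrite (bigD1 1%g) //= big1 ?addr0 => [|g n]; last first.
  by rewrite ffunE (negPf n) raddf0 linear0 zero_lfunE.
by rewrite ffunE eqxx rmorph1 amod_act1 id_lfunE invg1 mul1g.
Qed.

Fact pushdown_actM s t :
  pushdown_act (s * t) = (pushdown_act s \o pushdown_act t)%VF.
Proof.
apply/lfunP => x; apply/ffunP => k; rewrite comp_lfunE !pushdown_actE.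
under eq_bigr => g _ do rewrite ffunE raddf_sum linear_sum sum_lfunE.
under [RHS]eq_bigr => g _ do rewrite pushdown_actE linear_sum.
rewrite exchange_big /=; apply: eq_bigr => h _.
rewrite (reindex_inj (mulgI h)) /=; apply: eq_bigr => g _.
by rewrite mulKg rmorphM amod_actM comp_lfunE /= -aactM !invMg invgK mulgA.
Qed.

Definition pushdown : amod (skew_alg act) :=
  AMod pushdown_actP pushdown_act1 pushdown_actM.

End PushDown.

Definition pushdown_hom (M N : amod A) (f : 'Hom(M, N)) :
  'Hom(pushdown M, pushdown N) := ffmap gT f.

Lemma pushdown_hom_hom (M N : amod A) (f : 'Hom(M, N)) :
  is_hom f -> @is_hom K (skew_alg act) (pushdown M) (pushdown N) (pushdown_hom f).
Proof.
move=> hf s x; apply/ffunP => k; rewrite /= ffmapE !pushdown_actE linear_sum.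
by apply: eq_bigr => g _; rewrite /= ffmapE hf.
Qed.

Definition pushdown_pmod (theta : amod A) (M : pmod theta) :
    pmod (pushdown theta) :=
  @PMod K (skew_alg act) (pushdown theta) (pushdown M) (pushdown_hom (pt M))
    (pushdown_hom_hom (@pt_hom _ _ _ M)).

(* [pushdown M] is the extension of scalars of [M] along
   [a |-> a (x) 1]. *)
Section ExtensionOfScalars.
Variables (M : amod A) (X : amod (skew_alg act)).

Definition scal_unit (m : M) : pushdown M :=
  [ffun h => if h == 1%g then m else 0] : {ffun gT -> M}.

Lemma skew_act_scal_unit s m h :
  amod_act (pushdown M) s (scal_unit m) h = amod_act M (act h^-1%g (s h)) m.
Proof.
rewrite pushdown_actE (bigD1 h) //= big1 ?addr0 => [|g n].
  by rewrite ffunE mulVg eqxx.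
by rewrite ffunE -eq_mulVg1 (negPf n) linear0.
Qed.

Lemma pushdown_scal_unit (x : pushdown M) :
  x = \sum_(h : gT) amod_act (pushdown M) (skew_elt act 1 h) (scal_unit (x h)).
Proof.
apply/ffunP => k; rewrite sum_ffunE (bigD1 k) //= big1 ?addr0 => [|g n].
  by rewrite skew_act_scal_unit ffunE eqxx rmorph1 amod_act1 id_lfunE.
rewrite skew_act_scal_unit ffunE eq_sym (negPf n) raddf0 linear0.
by rewrite zero_lfunE.
Qed.

Lemma pushdown_universal (f : 'Hom(M, X)) :
  (forall a m, f (amod_act M a m) = amod_act X (skew_elt act a 1%g) (f m)) ->
  exists! phi : 'Hom(pushdown M, X),
    is_hom phi /\ forall m, phi (scal_unit m) = f m.
Proof.
move=> hf.
pose F (x : pushdown M) : X :=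
  \sum_(h : gT) amod_act X (skew_elt act 1 h) (f (x h)).
have Flin : linear F.
  move=> c x y; rewrite /F scaler_sumr -big_split; apply: eq_bigr => h _ /=.
  by rewrite !ffunE !linearP.
pose FL : {linear pushdown M -> X} :=
  HB.pack F (GRing.isLinear.Build K (pushdown M) X _ F Flin).
exists (linfun FL); split; first split.
- move=> s x; rewrite !(lfunE FL) /FL /= /F linear_sum /=.
  under eq_bigr => k _ do rewrite (@pushdown_actE M) !linear_sum /=.
  rewrite exchange_big /= [RHS](eq_bigr (fun h => \sum_(g : gT)
    amod_act X (skew_elt act (s g) (g * h)%g) (f (x h)))); last first.
    move=> h _; rewrite -amod_actMx.
    rewrite -sum_lfunE -linear_sum; congr (amod_act X _ _).
    apply/ffunP => k; rewrite ffunE sum_ffunE; apply: eq_bigr => g _.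
    rewrite !ffunE -(inj_eq (mulgI g)) mulKVg.
    by case: eqP; rewrite ?rmorph1 ?mulr1 // raddf0 mulr0.
  rewrite [RHS]exchange_big /=; apply: eq_bigr => g _.
  rewrite (reindex_inj (mulgI g)) /=; apply: eq_bigr => h _.
  rewrite mulKg hf -amod_actMx skew_eltM mul1r mulg1.
  by rewrite aactVK.
- move=> m; rewrite (lfunE FL) /FL /= /F (bigD1 1%g) //= big1 ?addr0 => [|g n].
    by rewrite ffunE eqxx (@amod_act1 K (skew_alg act) X) id_lfunE.
  by rewrite ffunE (negPf n) !linear0.
move=> phi [hphi e]; apply/lfunP => x.
rewrite [in RHS](pushdown_scal_unit x) linear_sum (lfunE FL) /FL /= /F.
by apply: eq_bigr => h _; rewrite hphi e.
Qed.

End ExtensionOfScalars.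

(** ** Galois semi-coverings *)

(* For [g] the isomorphism from [pushdown M] to [pushdown (twist g M)] that
   sends [(1 (x) h) (x) m] to [(1 (x) hg^-1) (x) m]; for [g^-1] its inverse. *)
Section Shift.
Variables (V : vectType K) (g : gT).
Definition shift_fun (x : {ffun gT -> V}) : {ffun gT -> V} :=
  [ffun k => x (k * g)%g].
Fact shift_is_linear : linear shift_fun.
Proof. by move=> c x y; apply/ffunP => k; rewrite !ffunE. Qed.
HB.instance Definition _ := GRing.isLinear.Build K {ffun gT -> V}
  {ffun gT -> V} _ shift_fun shift_is_linear.
Definition shift : 'End({ffun gT -> V}) := linfun shift_fun.
Lemma shiftE x k : shift x k = x (k * g)%g. Proof. by rewrite lfunE ffunE. Qed.
End Shift.

Definition shift_to (g : gT) (M : amod A) :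
  'Hom(pushdown M, pushdown (twist g M)) := shift M g.
Definition shift_from (g : gT) (M : amod A) :
  'Hom(pushdown (twist g M), pushdown M) := shift M g^-1%g.

Lemma shift_to_hom g M : is_hom (shift_to g M).
Proof.
move=> s x; apply/ffunP => k; rewrite /= shiftE pushdown_actE.
rewrite [RHS](@pushdown_actE (twist g M)).
apply: eq_bigr => h _; rewrite [RHS]/= shiftE /= /twist_act -aactM.
by rewrite invMg mulgA.
Qed.

Lemma shift_fromK g M : cancel (shift_from g M) (shift_to g M).
Proof. by move=> x; apply/ffunP => k; rewrite !shiftE mulgK. Qed.

Lemma shift_toK g M : cancel (shift_to g M) (shift_from g M).
Proof. by move=> x; apply/ffunP => k; rewrite !shiftE mulgKV. Qed.

Definition fam_twist_source (M N : amod A) (f : {ffun gT -> 'Hom(M, N)}) :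
    'Hom(pushdown M, pushdown N) :=
  (\sum_(g : gT) (@pushdown_hom (twist g M) N (f g) \o shift_to g M))%VF.

Definition fam_twist_target (M N : amod A) (f : {ffun gT -> 'Hom(M, N)}) :
    'Hom(pushdown M, pushdown N) :=
  (\sum_(g : gT) (shift_from g N \o @pushdown_hom M (twist g N) (f g)))%VF.

(* The map [Phi], which is linear in all uses below, restricts to a bijection
   from the subspace [D] of its source to the space of homomorphisms. *)
Definition onto_homs (V : vectType K) (M N : amod (skew_alg act))
    (D : V -> Prop) (Phi : V -> 'Hom(M, N)) : Prop :=
  (forall v, D v -> is_hom (Phi v)) /\
  (forall h, is_hom h -> exists! v, D v /\ Phi v = h).

Definition galois_semi_covering : Prop :=
  forall M N : amod A,
  [/\ ~ full_stab M ->
        onto_homs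
          (fun f : {ffun gT -> 'Hom(M, N)} =>
             forall g, @is_hom K A (twist g M) N (f g))
          (@fam_twist_source M N),
      ~ full_stab N ->
        onto_homs
          (fun f : {ffun gT -> 'Hom(M, N)} =>
             forall g, @is_hom K A M (twist g N) (f g))
          (@fam_twist_target M N)
    & full_stab M -> full_stab N ->
      forall u : forall g : gT, 'Hom(twist g M, M), (forall g, hom_iso (u g)) ->
        onto_homs
          (fun f : {ffun gT -> 'Hom(M, N)} => forall g, is_hom (f g))
          (fun f => fam_twist_source [ffun g => f g \o u g]%VF)].

End Twist.

(* Main.v *)
From HB Require Import structures.
Require Import Defs.
From mathcomp Require Import all_boot all_order all_algebra.
From mathcomp Require Import all_fingroup all_solvable all_field all_character.
From Stdlib Require Import FunctionalExtensionality PropExtensionality.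
From Stdlib Require Import ProofIrrelevance.

(** Write F for the push-down functor and n for the order of G.  As a module
    over the original algebra, F M is the direct sum of the n twists of M, so
    a homomorphism Phi from F M to F N is an n by n matrix of blocks, the block
    at (k, h) being a homomorphism from the h-th twist of M to the k-th twist
    of N.  Commuting with the group elements of the skew group algebra makes
    the matrix invariant under translation, so all the diagonal blocks are the
    block at (1, 1), which is a homomorphism from M to N.

    If Phi is pointed, so is its (1, 1) block, because F sends an element l of
    theta placed in coordinate 1 to the point of M placed in coordinate 1.
    Hence pointed homomorphisms F M -> F N and M -> N exist simultaneously
    [pushdown_phom_exists].  As F also preserves pointed direct sums and pointed
    pushouts, it embeds the poset of classes with the operations that occur in
    wideness, which gives the second claim.

    For the first claim let M and N have local endomorphism rings, with no
    nontrivial twist of M isomorphic to N.  If Phi : F M -> F N is an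
    isomorphism with inverse Psi, the identity of M is the sum over j of the
    products Psi(1, j) Phi(j, 1).  By locality one of them is invertible, so
    Phi(j, 1) is an isomorphism from M to the j-th twist of N, and then j = 1
    [block1_iso].  Thus F reflects pointed isomorphisms.  Conversely, take N = M:
    an endomorphism of F M whose (1, 1) block is invertible is invertible: the
    diagonal blocks are invertible and a path through another twist of M is
    never invertible, so Gaussian elimination succeeds [elimination].  So
    invertibility in the endomorphism ring of F M is detected in that of M, and
    the former ring is local because the latter is [pushdown_local_end].  The
    pushouts of the given chains are handled in the same way, through the
    isomorphism between the pushout of F M and F N and the push-down of the
    pushout. *)

Set Implicit Arguments.
Unset Strict Implicit.
Unset Printing Implicit Defensive.

Import GRing.Theory.
Local Open Scope ring_scope.

(** * Isomorphisms and local endomorphism rings *)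

Section ModuleIsomorphisms.
Variables (K : fieldType) (A : falgType K).
Implicit Types M N P : amod A.

Lemma hom_id M : is_hom (\1%VF : 'End(M)).
Proof. by move=> a x; rewrite !id_lfunE. Qed.

Lemma hom_sum M N (I : Type) (r : seq I) (f : I -> 'Hom(M, N)) :
  (forall i, is_hom (f i)) -> is_hom (\sum_(i <- r) f i).
Proof.
move=> hf a x; rewrite !sum_lfunE linear_sum.
by apply: eq_bigr => i _; rewrite hf.
Qed.

Lemma homB M N (f g : 'Hom(M, N)) : is_hom f -> is_hom g -> is_hom (f - g).
Proof.
by move=> hf hg a x; rewrite !add_lfunE !opp_lfunE hf hg !linearD linearN.
Qed.

Lemma lker0_of_inj M N (f : 'Hom(M, N)) :
  (forall x, f x = 0 -> x = 0) -> lker f == 0%VS.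
Proof.
move=> inj; rewrite -subv0; apply/subvP => x; rewrite memv_ker => /eqP /inj ->.
exact: mem0v.
Qed.

Lemma hom_iso_bij M N (f : 'Hom(M, N)) : is_hom f ->
  (forall x, f x = 0 -> x = 0) -> (forall y, exists x, f x = y) -> hom_iso f.
Proof.
move=> hf inj surj.
have fK := lker0_lfunK (lker0_of_inj inj).
have Kf : cancel (f^-1)%VF f.
  by move=> y; have [x <-] := surj y; rewrite fK.
split=> //; exists (f^-1)%VF => //.
by move=> a y; apply: (can_inj fK); rewrite Kf hf Kf.
Qed.

Lemma hom_iso_inj M (f : 'End(M)) :
  is_hom f -> (forall x, f x = 0 -> x = 0) -> hom_iso f.
Proof.
move=> hf inj; apply: hom_iso_bij => // y.
by exists ((f^-1)%VF y); rewrite lker0_lfunVK ?lker0_of_inj.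
Qed.

Lemma hom_iso_id M : hom_iso (\1%VF : 'End(M)).
Proof.
split; first exact: hom_id.
by exists \1%VF; [exact: hom_id | split=> x; rewrite !id_lfunE].
Qed.

Lemma hom_iso_comp M N P (f : 'Hom(N, P)) (g : 'Hom(M, N)) :
  hom_iso f -> hom_iso g -> hom_iso (f \o g)%VF.
Proof.
move=> [hf [f' hf' [fK f'K]]] [hg [g' hg' [gK g'K]]].
split; first exact: hom_comp.
exists (g' \o f')%VF; first exact: hom_comp.
by split=> x; rewrite !comp_lfunE ?fK ?gK ?g'K ?f'K.
Qed.

Lemma isomorphic_sym M N : isomorphic M N -> isomorphic N M.
Proof.
by move=> [f [hf [g hg [fK gK]]]]; exists g; split=> //; exists f.
Qed.

(** Correct v to a left inverse v' of u.  The endomorphism e = u v' of N is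
    idempotent, and e or 1 - e is invertible by locality.  An invertible
    idempotent is 1, and 1 - e cannot be 1 since e u = u is not zero. *)
Lemma local_end_split M N (u : 'Hom(M, N)) (v : 'Hom(N, M)) :
  (\1%VF != 0 :> 'End(M)) -> local_end N -> is_hom u -> is_hom v ->
  hom_iso (v \o u)%VF -> hom_iso u.
Proof.
move=> M0 [_ locN] hu hv [_ [w hw [wK _]]].
pose v' := (w \o v)%VF.
have hv' : is_hom v' by exact: hom_comp.
have uK : cancel u v' by move=> x; rewrite comp_lfunE -[RHS]wK comp_lfunE.
pose e := (u \o v')%VF.
have he : is_hom e by exact: hom_comp.
have eE x : e x = u (v' x) by rewrite comp_lfunE.
have: hom_iso (e + (\1%VF - e)) by rewrite addrC subrK; exact: hom_iso_id.
case/locN => // [|[_ [e' _ [eK _]]]|[_ [e' _ [eK _]]]].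
- exact: homB (@hom_id N) he.
- split=> //; exists v' => //; split=> // y; rewrite -eE.
  by apply: (can_inj eK); rewrite !eE uK.
- case/eqP: M0; apply/lfunP => x; rewrite id_lfunE zero_lfunE -[x]uK.
  suff -> : u x = 0 by rewrite linear0.
  apply: (can_inj eK); rewrite linear0 add_lfunE opp_lfunE id_lfunE eE uK.
  exact: subrr.
Qed.

Lemma local_end_sum M (I : Type) (r : seq I) (f : I -> 'End(M)) :
  local_end M -> (forall i, is_hom (f i)) ->
  hom_iso (\sum_(i <- r) f i) -> exists i, hom_iso (f i).
Proof.
move=> [M0 locM] hf; elim: r => [|i r IH].
  rewrite big_nil => -[_ [g _ [gK _]]]; case/eqP: M0; apply/lfunP => x.
  by rewrite id_lfunE zero_lfunE -[x]gK zero_lfunE linear0.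
rewrite big_cons => /locM [//||fi|/IH //]; first exact: hom_sum.
by exists i.
Qed.

Lemma local_end_iso M N : isomorphic M N -> local_end M -> local_end N.
Proof.
move=> [f if_]; have [hf [g hg [fK gK]]] := if_.
have ig : hom_iso g by split=> //; exists f.
move=> [M0 locM]; split.
  apply/eqP => e; case/eqP: M0; apply/lfunP => x.
  have := congr1 (fun u : 'End(N) => g (u (f x))) e.
  by rewrite /= !id_lfunE !zero_lfunE linear0 fK.
move=> a b ha hb iab.
pose c (u : 'End(N)) : 'End(M) := (g \o (u \o f))%VF.
have cE u : u = (f \o (c u \o g))%VF.
  by apply/lfunP => x; rewrite !comp_lfunE !gK.
have hc u : is_hom u -> is_hom (c u).
  by move=> hu; do 2!apply: hom_comp => //.
have ic u : hom_iso (c u) -> hom_iso u.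
  by move=> iu; rewrite (cE u); do 2!apply: hom_iso_comp => //.
have : hom_iso (c a + c b).
  have -> : c a + c b = c (a + b).
    by apply/lfunP => x; rewrite !(add_lfunE, comp_lfunE) linearD.
  by do 2!apply: hom_iso_comp => //.
by case/(locM _ _ (hc _ ha) (hc _ hb)) => /ic; [left | right].
Qed.

(** The first isomorphism theorem, for the quotients realized on a
    complement. *)
Section Quotient.
Variables (M N : amod A) (U : {vspace M}) (subU : is_submod U).
Variable p : 'Hom(M, N).
Hypothesis hp : is_hom p.
Hypothesis kerp : forall x, p x = 0 <-> x \in U.
Hypothesis surjp : forall y, exists x, p x = y.

Definition quot_induced : 'Hom(quot_mod subU, N) := (p \o quot_lift U)%VF.

Lemma quot_induced_proj x : quot_induced (quot_proj U x) = p x.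
Proof.
rewrite comp_lfunE; apply/eqP; rewrite eq_sym -subr_eq0 -linearB; apply/eqP.
by apply/kerp; exact: quot_projK.
Qed.

Lemma quot_induced_iso : hom_iso quot_induced.
Proof.
have pE w : w = quot_proj U (quot_lift U w) by rewrite quot_liftK.
apply: hom_iso_bij => [a w|w|y].
- have e : amod_act (quot_mod subU) a w =
      quot_proj U (amod_act M a (quot_lift U w)).
    by rewrite {1}(pE w); exact: quot_act_proj.
  by rewrite e [in RHS](pE w) !quot_induced_proj hp.
- by rewrite (pE w) quot_induced_proj => /kerp; rewrite -quot_proj_eq0 => /eqP.
- by have [x <-] := surjp y; exists (quot_proj U x); exact: quot_induced_proj.
Qed.
End Quotient.

End ModuleIsomorphisms.

(** * The poset of pointed modules *)

Section PointedModules.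
Variables (K : fieldType) (A : falgType K) (theta : amod A).
Implicit Types M N P : pmod theta.

Lemma phom_exists_refl M : phom_exists M M.
Proof.
exists \1%VF; split; first exact: hom_id.
by move=> l; rewrite id_lfunE.
Qed.

Lemma phom_exists_trans N M P :
  phom_exists M N -> phom_exists N P -> phom_exists M P.
Proof.
move=> [f [hf pf]] [g [hg pg]]; exists (g \o f)%VF; split.
  exact: hom_comp.
by move=> l; rewrite comp_lfunE pf pg.
Qed.

Lemma theta_isomorphic_sym M N : theta_isomorphic M N -> theta_isomorphic N M.
Proof.
move=> [f [[hf pf] [_ [g hg [fK gK]]]]].
exists g; split; last by split=> //; exists f.
by split=> // l; rewrite -pf fK.
Qed.

Lemma theta_isomorphic_trans N M P :
  theta_isomorphic M N -> theta_isomorphic N P -> theta_isomorphic M P.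
Proof.
move=> [f [[hf pf] if_]] [g [[hg pg] ig]]; exists (g \o f)%VF; split.
  by split=> [|l]; [exact: hom_comp | rewrite comp_lfunE pf pg].
exact: hom_iso_comp.
Qed.

Lemma theta_isomorphic_pequiv M N : theta_isomorphic M N -> pequiv M N.
Proof.
move=> iMN; have [g [pg _]] := theta_isomorphic_sym iMN.
by have [f [pf _]] := iMN; split; [exists f | exists g].
Qed.

(** A class is a predicate together with a proof that it is one, so equality of
    classes needs extensionality for the predicate and irrelevance for the
    proof. *)
Lemma pcls_eqP M N : pcls M = pcls N <-> pequiv M N.
Proof.
split=> [e|[MN NM]].
  have : pequiv N N by split; exact: phom_exists_refl.
  have /= <- := congr1 (@proj1_sig _ _) e.
  by [].
have e : pequiv M = pequiv N.
  apply: functional_extensionality => P; apply: propositional_extensionality.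
  by split=> -[P1 P2]; split;
    [exact: phom_exists_trans NM P1 | exact: phom_exists_trans P2 MN
    |exact: phom_exists_trans MN P1 | exact: phom_exists_trans P2 NM].
by apply: eq_sig_hprop => // X; exact: proof_irrelevance.
Qed.

Lemma pclass_leP M N : pclass_le (pcls M) (pcls N) <-> phom_exists N M.
Proof.
split=> [[M' [N' [/pcls_eqP [MM' M'M] /pcls_eqP [NN' N'N] N'M']]]|NM].
  exact: phom_exists_trans NN' (phom_exists_trans N'M' M'M).
by exists M, N.
Qed.

Lemma pclass_ltP M N :
  pclass_lt (pcls M) (pcls N) <-> phom_exists N M /\ ~ phom_exists M N.
Proof.
split=> [[/pclass_leP NM n]|[NM n]].
  by split=> // MN; apply: n; apply/pcls_eqP.
by split=> [|/pcls_eqP [MN _]]; [apply/pclass_leP | exact: n].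
Qed.

End PointedModules.

(** * Twisted modules *)

Section Twists.
Variables (gT : finGroupType) (K : fieldType) (A : falgType K).
Variable act : alg_action gT A.
Implicit Types M N : amod A.

Lemma twist_hom g M N (f : 'Hom(M, N)) :
  @is_hom K A (twist act g M) (twist act g N) f <-> is_hom f.
Proof.
split=> hf a x; last exact: hf.
by have := hf (act g a) x; rewrite /= /twist_act aactK.
Qed.

Lemma twist_iso g M N (f : 'Hom(M, N)) :
  @hom_iso K A (twist act g M) (twist act g N) f <-> hom_iso f.
Proof.
split=> -[hf [f' hf' fK]].
  by split; [|exists f' => //]; apply/(twist_hom g).
by split; [apply/twist_hom | exists f' => //; apply/twist_hom].
Qed.

Lemma twist_local_end g M : local_end M -> local_end (twist act g M).
Proof.
move=> [M0 locM]; split=> // f f' /twist_hom hf /twist_hom hf' /twist_iso.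
by case/(locM f f' hf hf') => /twist_iso; [left | right].
Qed.

Lemma twistM_hom g h k M N (f : 'Hom(M, N)) :
  @is_hom K A (twist act h M) (twist act k N) f ->
  @is_hom K A (twist act (g * h)%g M) (twist act (g * k)%g N) f.
Proof.
move=> hf a x; have := hf (act g^-1%g a) x.
by rewrite /= /twist_act !invMg !aactM.
Qed.

Lemma twistM_isomorphic g h k M N :
  isomorphic (twist act h M) (twist act k N) ->
  isomorphic (twist act (g * h)%g M) (twist act (g * k)%g N).
Proof.
move=> [f [hf [f' hf' fK]]]; exists f; split; first exact: twistM_hom hf.
by exists f' => //; exact: twistM_hom hf'.
Qed.

Lemma twist1_hom M N (f : 'Hom(M, N)) h :
  @is_hom K A (twist act h M) (twist act 1%g N) f <->
  @is_hom K A (twist act h M) N f.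
Proof.
by split=> hf a x; have := hf a x; rewrite /= /twist_act ?invg1 ?aact1.
Qed.

Lemma twist1_isomorphic M N h :
  isomorphic (twist act h M) (twist act 1%g N) -> isomorphic (twist act h M) N.
Proof.
move=> [f [/twist1_hom hf [f' hf' fK]]]; exists f; split=> //.
exists f' => // a x; have := hf' a x.
by rewrite /= /twist_act ?invg1 ?aact1.
Qed.

Definition twist_disjoint M N : Prop :=
  forall g, g != 1%g -> ~ isomorphic (twist act g M) N.

Lemma twist_disjoint_eq M N h k :
  twist_disjoint M N -> isomorphic (twist act h M) (twist act k N) -> h = k.
Proof.
move=> dMN /(twistM_isomorphic k^-1%g); rewrite mulVg => /twist1_isomorphic i.
apply/eqP; rewrite eq_sym eq_mulVg1; apply/negPn/negP => n.
exact: dMN n i.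
Qed.

End Twists.

(** * Homomorphisms of push-downs as matrices *)

Section Blocks.
Variables (gT : finGroupType) (K : fieldType) (A : falgType K).
Variable act : alg_action gT A.
Implicit Types M N P : amod A.

Definition single_fun (V : vectType K) (h : gT) (m : V) : {ffun gT -> V} :=
  [ffun k => if k == h then m else 0].
Fact single_is_linear (V : vectType K) h : linear (@single_fun V h).
Proof.
move=> c x y; apply/ffunP => k; rewrite !ffunE.
by case: eqP; rewrite ?scaler0 ?addr0.
Qed.
HB.instance Definition _ (V : vectType K) h :=
  GRing.isLinear.Build K V {ffun gT -> V} _ (@single_fun V h) (single_is_linear h).
Definition single (V : vectType K) h : 'Hom(V, {ffun gT -> V}) :=
  linfun (@single_fun V h).

Definition coord_fun (V : vectType K) (k : gT) (x : {ffun gT -> V}) : V := x k.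
Fact coord_is_linear (V : vectType K) k : linear (@coord_fun V k).
Proof. by move=> c x y; rewrite /coord_fun !ffunE. Qed.
HB.instance Definition _ (V : vectType K) k :=
  GRing.isLinear.Build K {ffun gT -> V} V _ (@coord_fun V k) (coord_is_linear k).
Definition coordinate (V : vectType K) k : 'Hom({ffun gT -> V}, V) :=
  linfun (@coord_fun V k).

Lemma singleE (V : vectType K) h (m : V) k :
  single V h m k = if k == h then m else 0.
Proof. by rewrite lfunE ffunE. Qed.

Lemma coordinateE (V : vectType K) k (x : {ffun gT -> V}) :
  coordinate V k x = x k.
Proof. by rewrite lfunE. Qed.

Lemma sum_single (V : vectType K) (x : {ffun gT -> V}) :
  x = \sum_h single V h (x h).
Proof.
apply/ffunP => k; rewrite sum_ffunE (bigD1 k) //= big1 => [|h n].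
  by rewrite singleE eqxx addr0.
by rewrite singleE eq_sym (negPf n).
Qed.

Lemma pushdown_act_elt M a g x k :
  amod_act (pushdown act M) (skew_elt act a g) x k =
  amod_act M (act k^-1%g a) (x (g^-1 * k)%g).
Proof.
rewrite pushdown_actE (bigD1 g) //= big1 => [|h n].
  by rewrite ffunE eqxx addr0.
by rewrite ffunE (negPf n) raddf0 linear0 zero_lfunE.
Qed.

Section OneMap.
Variables (M N : amod A) (Phi : 'Hom(pushdown act M, pushdown act N)).

Definition block (k h : gT) : 'Hom(M, N) :=
  (coordinate N k \o (Phi \o single M h))%VF.

Lemma blockE k h m : block k h m = Phi (single M h m) k.
Proof. by rewrite !comp_lfunE coordinateE. Qed.

Lemma sum_block x k : Phi x k = \sum_h block k h (x h).
Proof.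
rewrite {1}[x]sum_single linear_sum sum_ffunE.
by apply: eq_bigr => h _; rewrite blockE.
Qed.

Hypothesis hPhi : is_hom Phi.

(** The element a (x) 1 acts on the coordinate h of F M as a acts on the h-th
    twist of M, and it does not mix coordinates. *)
Lemma block_hom k h : @is_hom K A (twist act h M) (twist act k N) (block k h).
Proof.
move=> a m; rewrite !blockE.
have -> : single M h (amod_act (twist act h M) a m) =
    amod_act (pushdown act M) (skew_elt act a 1%g) (single M h m).
  apply/ffunP => j; rewrite pushdown_act_elt invg1 mul1g.
  rewrite !singleE; by case: eqP => [->|_] //; rewrite linear0.
by rewrite hPhi pushdown_act_elt invg1 mul1g.
Qed.

(** The element 1 (x) g moves the coordinate h to the coordinate gh. *)
Lemma block_translate g k h : block (g * k)%g (g * h)%g = block k h.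
Proof.
apply/lfunP => m; rewrite !blockE.
have -> : single M (g * h)%g m =
    amod_act (pushdown act M) (skew_elt act 1 g) (single M h m).
  apply/ffunP => j; rewrite pushdown_act_elt rmorph1 amod_act1 id_lfunE.
  by rewrite !singleE -[RHS]/(if (g^-1 * j == h)%g then m else 0)
    -[in RHS](inj_eq (mulgI g)) mulKVg.
by rewrite hPhi pushdown_act_elt rmorph1 amod_act1 id_lfunE mulKg.
Qed.

Lemma block1_hom : is_hom (block 1 1).
Proof. by apply/(twist_hom act 1%g); exact: block_hom. Qed.

Lemma block_diag k : block k k = block 1 1.
Proof. by rewrite -(block_translate k 1 1) mulg1. Qed.

End OneMap.

Lemma block_comp M N P (Phi : 'Hom(pushdown act M, pushdown act N))
    (Psi : 'Hom(pushdown act N, pushdown act P)) k h :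
  block (Psi \o Phi)%VF k h = \sum_j (block Psi k j \o block Phi j h)%VF.
Proof.
apply/lfunP => m; rewrite blockE comp_lfunE sum_block sum_lfunE.
by apply: eq_bigr => j _; rewrite comp_lfunE (blockE Phi).
Qed.

Lemma block_id M h : @block M M \1%VF h h = \1%VF.
Proof. by apply/lfunP => m; rewrite blockE !id_lfunE singleE eqxx. Qed.

(** The identity of M is the sum of the paths from M through the twists of N
    back to M, so locality makes one of them invertible.  The twist of N that
    it visits is then isomorphic to M, hence is N itself. *)
Lemma block1_iso M N (Phi : 'Hom(pushdown act M, pushdown act N)) :
  local_end M -> local_end N -> twist_disjoint act M N ->
  hom_iso Phi -> hom_iso (block Phi 1 1).
Proof.
move=> locM locN dMN [hPhi [Psi hPsi [PhiK _]]].
have sum1 : \sum_j (block Psi 1 j \o block Phi j 1)%VF = \1%VF.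
  rewrite -block_comp -(block_id M 1%g); congr block.
  by apply/lfunP => x; rewrite comp_lfunE PhiK id_lfunE.
have hterm j : is_hom (block Psi 1 j \o block Phi j 1)%VF.
  apply/(twist_hom act 1%g); apply: (hom_comp (N := twist act j N));
    exact: block_hom.
have iso1 : hom_iso (\sum_j (block Psi 1 j \o block Phi j 1)%VF).
  by rewrite sum1; exact: hom_iso_id.
have [j /(twist_iso act 1%g) ij] := local_end_sum locM hterm iso1.
have iPhi : @hom_iso K A (twist act 1 M) (twist act j N) (block Phi j 1).
  apply: (local_end_split
    (v := (block Psi 1 j : 'Hom(twist act j N, twist act 1 M)))) => //.
  - by case: locM.
  - exact: twist_local_end.
  - exact: block_hom.
  - exact: block_hom.
have j1 : 1%g = j by apply: (twist_disjoint_eq dMN); exists (block Phi j 1).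
by move: iPhi; rewrite -j1 => /twist_iso.
Qed.

(** A square system whose coefficients B k h run between pairwise
    non-isomorphic twists of M, with invertible diagonal, has only the zero
    solution.  Eliminating the unknown i replaces B k h by the Schur complement
    B k h - B k i (B i i)^-1 B i h.  Its diagonal stays invertible: by locality
    it could fail only if the correction, which factors through the i-th twist,
    were invertible, and then the k-th and i-th twists would be isomorphic. *)
Lemma elimination M (S : {set gT}) (B : gT -> gT -> 'End(M)) (x : gT -> M) :
  local_end M -> twist_disjoint act M M ->
  (forall k h, @is_hom K A (twist act h M) (twist act k M) (B k h)) ->
  (forall k, k \in S -> hom_iso (B k k)) ->
  (forall k, k \in S -> \sum_(h in S) B k h (x h) = 0) ->
  forall h, h \in S -> x h = 0.
Proof.
move=> locM dM.
elim: {S}#|S| {-2}S (leqnn #|S|) B x => [|n IH] S leSn B x hB iB Bx i iS.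
  by move: leSn; rewrite leqn0 cards_eq0 => /eqP S0; rewrite S0 inE in iS.
have [_ [Bi hBi [BiK iBK]]] := iB i iS.
pose C k h := B k h - (B k i \o (Bi \o B i h))%VF.
have hBi' : @is_hom K A (twist act i M) (twist act i M) Bi by apply/twist_hom.
have hcomp k h :
    @is_hom K A (twist act h M) (twist act k M) (B k i \o (Bi \o B i h))%VF.
  apply: (hom_comp (N := twist act i M)); first exact: hB.
  by apply: (hom_comp (N := twist act i M)); [exact: hBi' | exact: hB].
have hC k h : @is_hom K A (twist act h M) (twist act k M) (C k h).
  exact: homB (hB k h) (hcomp k h).
(* Row i of the system, solved for x i. *)
have xi : x i = - Bi (\sum_(h in S :\ i) B i h (x h)).
  apply: (can_inj BiK); rewrite linearN /= iBK; apply/eqP; rewrite -addr_eq0.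
  by rewrite -(big_setD1 i) //= Bx.
have x0 h : h \in S :\ i -> x h = 0.
  move: h; apply: (IH _ _ C) => // [|k|k].
  - by rewrite (cardsD1 i) iS in leSn.
  - rewrite !inE => /andP [nki kS].
    have: hom_iso (C k k + (B k i \o (Bi \o B i k))%VF).
      by rewrite subrK; exact: iB.
    case: (locM) => _ /[apply] -[||//|/(twist_iso act k) ic].
    + by apply/(twist_hom act k).
    + by apply/(twist_hom act k).
    have ic' : @hom_iso K A (twist act k M) (twist act i M) (Bi \o B i k)%VF.
      apply: (local_end_split
        (v := (B k i : 'Hom(twist act i M, twist act k M)))) => //.
      * by case: locM.
      * exact: twist_local_end.
      * by apply: (hom_comp (N := twist act i M)).
    case/eqP: nki; apply: (twist_disjoint_eq dM).
    by exists (Bi \o B i k)%VF.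
  - rewrite !inE => /andP [nki kS].
    under eq_bigr => h _ do rewrite add_lfunE opp_lfunE !comp_lfunE.
    rewrite sumrB -!linear_sum -[X in _ - B k i X]opprK -xi linearN opprK addrC.
    by rewrite -(big_setD1 i) //= Bx.
by rewrite xi big1 ?linear0 ?oppr0 // => k kS; rewrite x0 ?linear0.
Qed.

(** In finite dimension injectivity suffices, and the kernel is the solution
    set of the system whose coefficients are the blocks. *)
Lemma iso_of_block1 M (Phi : 'End(pushdown act M)) :
  local_end M -> twist_disjoint act M M ->
  @is_hom _ _ (pushdown act M) (pushdown act M) Phi ->
  hom_iso (@block M M Phi 1 1) ->
  @hom_iso _ _ (pushdown act M) (pushdown act M) Phi.
Proof.
move=> locM dM hPhi i1; apply: hom_iso_inj => // x Phix0.
apply/ffunP => h; rewrite [RHS]ffunE.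
apply: (elimination (S := setT) (B := @block M M Phi) (x := x)) => //.
- by move=> k j; exact: block_hom.
- by move=> k _; rewrite block_diag.
- move=> k _; rewrite (eq_bigl xpredT) => [|j]; last by rewrite inE.
  by rewrite -sum_block Phix0 ffunE.
Qed.

Lemma pushdown_local_end M :
  local_end M -> twist_disjoint act M M -> local_end (pushdown act M).
Proof.
move=> locM dM; have [M0 locM'] := locM; split.
  apply: contraNneq M0 => e; rewrite -(block_id M 1%g) e; apply/eqP/lfunP => m.
  by rewrite blockE !zero_lfunE ffunE.
move=> f g hf hg /(block1_iso locM locM dM).
have -> : @block M M (f + g) 1 1 = @block M M f 1 1 + @block M M g 1 1.
  by apply/lfunP => m; rewrite add_lfunE !blockE add_lfunE ffunE.
case/locM' => [||i|i]; try exact: block1_hom.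
- by left; exact: iso_of_block1.
- by right; exact: iso_of_block1.
Qed.

End Blocks.

(** * Push-down of pointed modules *)

Section PushdownPointed.
Variables (gT : finGroupType) (K : fieldType) (A : falgType K).
Variables (act : alg_action gT A) (theta : amod A).
Implicit Types M N : pmod theta.
Local Notation F := (pushdown_pmod act).

Lemma block1_phom M N (Phi : 'Hom(F M, F N)) :
  @is_phom _ _ _ (F M) (F N) Phi ->
  @is_phom _ _ _ M N (@block _ _ _ act M N Phi 1 1).
Proof.
move=> [hPhi pPhi]; split; first exact: block1_hom.
move=> l; rewrite blockE.
have -> : single M 1%g (pt M l) = pt (F M) (single theta 1%g l).
  apply/ffunP => k; rewrite ffmapE !singleE.
  by case: eqP => // _; rewrite linear0.
by rewrite pPhi ffmapE singleE eqxx.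
Qed.

Lemma pushdown_phom M N (f : 'Hom(M, N)) :
  is_phom f -> @is_phom _ _ _ (F M) (F N) (pushdown_hom act f).
Proof.
move=> [hf pf]; split; first exact: pushdown_hom_hom.
by move=> l; apply/ffunP => k; rewrite !ffmapE pf.
Qed.

(** Together with the poset order being defined by pointed homomorphisms, this
    makes push-down an order embedding on classes. *)
Lemma pushdown_phom_exists M N : phom_exists (F M) (F N) <-> phom_exists M N.
Proof.
split=> -[f pf]; last by exists (pushdown_hom act f); exact: pushdown_phom.
by exists (@block _ _ _ act M N f 1 1); exact: block1_phom.
Qed.

Lemma pushdown_pt_neq0 M : pt M != 0 -> pt (F M) != 0.
Proof.
apply: contraNneq => e; apply/eqP/lfunP => l.
have := congr1 (fun u : 'Hom(pushdown act theta, F M) =>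
  u (single theta 1%g l) 1%g) e.
by rewrite /= ffmapE singleE eqxx !zero_lfunE ffunE.
Qed.

Lemma pushdown_theta_isomorphic M N :
  local_end M -> local_end N -> twist_disjoint act M N ->
  theta_isomorphic (F M) (F N) -> theta_isomorphic M N.
Proof.
move=> locM locN dMN [Phi [pPhi iPhi]].
exists (@block _ _ _ act M N Phi 1 1); split; first exact: block1_phom.
exact: block1_iso.
Qed.

(** The identification of pairs of families with families of pairs, which is
    how push-down commutes with direct sums. *)
Section ZipFfun.
Variables V W : vectType K.
Definition zip_fun (x : {ffun gT -> V} * {ffun gT -> W}) : {ffun gT -> V * W} :=
  [ffun k => (x.1 k, x.2 k)].
Fact zip_is_linear : linear zip_fun.
Proof. by move=> c x y; apply/ffunP => k; rewrite !ffunE. Qed.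
HB.instance Definition _ := GRing.isLinear.Build K
  ({ffun gT -> V} * {ffun gT -> W})%type {ffun gT -> V * W} _ zip_fun
  zip_is_linear.
Definition zip_ffun :
  'Hom(({ffun gT -> V} * {ffun gT -> W})%type, {ffun gT -> V * W}) :=
  linfun zip_fun.
Lemma zip_ffunE x k : zip_ffun x k = (x.1 k, x.2 k).
Proof. by rewrite lfunE ffunE. Qed.
End ZipFfun.

Definition pushdown_zip (M N : amod A) :
  'Hom(dsum (pushdown act M) (pushdown act N), pushdown act (dsum M N)) :=
  zip_ffun M N.

Lemma pushdown_zip_hom (M N : amod A) : is_hom (pushdown_zip M N).
Proof.
move=> s x; apply/ffunP => k; rewrite zip_ffunE pushdown_actE dsum_actE /=.
rewrite !pushdown_actE [RHS]surjective_pairing -lfstE -lsndE !linear_sum /=.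
by congr pair; apply: eq_bigr => g _;
  rewrite ?lfstE ?lsndE dsum_actE zip_ffunE.
Qed.

Lemma pushdown_zip_inj (M N : amod A) x : pushdown_zip M N x = 0 -> x = 0.
Proof.
case: x => x y /ffunP e; congr pair; apply/ffunP => k;
  by have := e k; rewrite zip_ffunE !ffunE => -[].
Qed.

Lemma pushdown_zip_surj (M N : amod A) y : exists x, pushdown_zip M N x = y.
Proof.
exists ([ffun k => (y k).1], [ffun k => (y k).2]); apply/ffunP => k.
by rewrite zip_ffunE !ffunE -surjective_pairing.
Qed.

Lemma pushdown_pdsum M N : theta_isomorphic (pdsum (F M) (F N)) (F (pdsum M N)).
Proof.
exists (pushdown_zip M N); split.
  split; first exact: pushdown_zip_hom.
  by move=> l; apply/ffunP => k; rewrite zip_ffunE !lpairE /= !ffmapE lpairE.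
apply: hom_iso_bij; [exact: pushdown_zip_hom | exact: pushdown_zip_inj |].
exact: pushdown_zip_surj.
Qed.

(** Both sides are quotients of F M (+) F N: a family of pairs is killed
    coordinatewise in the pushout of M and N exactly when its entries come from
    a family in theta, that is, from an element of F theta. *)
Lemma pushdown_ppushout M N :
  theta_isomorphic (ppushout (F M) (F N)) (F (ppushout M N)).
Proof.
pose q := quot_proj (amalg_rel M N).
have hq : @is_hom _ _ (dsum M N) (amalg M N) q by exact: quot_proj_hom.
pose p := (pushdown_hom act (q : 'Hom(dsum M N, amalg M N))
             \o pushdown_zip M N)%VF.
have hp : is_hom p.
  by apply: hom_comp; [exact: pushdown_hom_hom | exact: pushdown_zip_hom].
have pE x k : p x k = q (x.1 k, x.2 k).
  by rewrite comp_lfunE ffmapE zip_ffunE.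
have kerp x : p x = 0 <-> x \in amalg_rel (F M) (F N).
  split=> [px0|/memv_imgP [l _ ->]].
    (* A chosen preimage under r in each coordinate gives the family in
       theta. *)
    pose r := lpair (pt M) (- pt N).
    have rE k : (x.1 k, x.2 k) = r ((r^-1)%VF (x.1 k, x.2 k)).
      rewrite limg_lfunVK // -quot_proj_eq0; apply/eqP.
      by rewrite -/q -pE px0 ffunE.
    apply/memv_imgP; exists [ffun k => (r^-1)%VF (x.1 k, x.2 k)].
      exact: memvf.
    rewrite lpairE [LHS]surjective_pairing; congr pair; apply/ffunP => k.
      by have := congr1 fst (rE k); rewrite ffmapE ffunE lpairE.
    by have := congr1 snd (rE k); rewrite
      opp_lfunE !ffunE ffmapE ffunE lpairE opp_lfunE.
  apply/ffunP => k; rewrite pE ffunE lpairE; apply/eqP; rewrite quot_proj_eq0.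
  apply/memv_imgP; exists (l k); first exact: memvf.
  by rewrite lpairE /= !opp_lfunE !ffunE !ffmapE.
have surjp y : exists x, p x = y.
  have [x xE] := pushdown_zip_surj (ffmap gT (quot_lift (amalg_rel M N)) y).
  exists x; apply/ffunP => k; rewrite comp_lfunE xE !ffmapE.
  exact: quot_liftK.
exists (quot_induced (@amalg_rel_submod _ _ _ (F M) (F N)) p); split.
  split.
    by have [] := quot_induced_iso (@amalg_rel_submod _ _ _ (F M) (F N)) hp kerp
      surjp.
  move=> l.
  have -> : pt (ppushout (F M) (F N)) l =
      quot_proj (amalg_rel (F M) (F N)) (lpair (pt (F M)) 0 l).
    exact: comp_lfunE.
  rewrite quot_induced_proj //.
  apply/ffunP => k; rewrite pE lpairE /= !ffmapE zero_lfunE ffunE.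
  by rewrite [RHS]comp_lfunE lpairE zero_lfunE.
exact: quot_induced_iso.
Qed.

Lemma pushdown_wide (I : Type) (M : I -> pmod theta) :
  wide (pfamily_classes M) -> wide (pfamily_classes (fun p => F (M p))).
Proof.
move=> wM _ _ [p ->] [q ->].
have ltF (P P' : pmod theta) : pclass_lt (pcls (F P)) (pcls (F P')) <->
    pclass_lt (pcls P) (pcls P').
  have [h1 h2] := pushdown_phom_exists P P'.
  have [h3 h4] := pushdown_phom_exists P' P.
  by split=> /pclass_ltP [a b]; apply/pclass_ltP; split; tauto.
have leF (P P' : pmod theta) : pclass_le (pcls (F P)) (pcls (F P')) ->
    pclass_le (pcls P) (pcls P').
  by move=> /pclass_leP /pushdown_phom_exists /pclass_leP.
have clsF (P P' : pmod theta) : pcls P = pcls P' -> pcls (F P) = pcls (F P').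
  by move=> /pcls_eqP [? ?]; apply/pcls_eqP; split; apply/pushdown_phom_exists.
move=> /ltF lt; have [||P [P' [[[i iE] [j jE]] [n n'] [a b] [c d] [e f g]]]] :=
  wM _ _ _ _ lt.
- by exists p.
- by exists q.
have poE : pcls (ppushout (F P) (F P')) = pcls (F (ppushout P P')).
  by apply/pcls_eqP/theta_isomorphic_pequiv/pushdown_ppushout.
have dsE : pcls (pdsum (F P) (F P')) = pcls (F (pdsum P P')).
  by apply/pcls_eqP/theta_isomorphic_pequiv/pushdown_pdsum.
exists (F P), (F P'); rewrite poE dsE; split.
- by split; [exists i | exists j]; apply: clsF.
- by split=> /leF.
- by split; apply/ltF.
- by split; apply/ltF.
- by split; apply/ltF.
Qed.

Lemma rational_chain_inhabited (d : Order.disp_t) (C : porderType d) :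
  rational_chain C -> inhabited C.
Proof. by move=> [f [f' _ _] _]; exists; exact: f' 0. Qed.

Lemma pushdown_dense_chain (d : Order.disp_t) (C : porderType d)
    (M : C -> pmod theta) :
  (forall q q', twist_disjoint act (M q) (M q')) ->
  dense_chain M -> dense_chain (fun q => F (M q)).
Proof.
move=> dM [chC locM leM nM]; split=> // [q|q q' /leM|q q' n].
- have [locq ptq] := locM q; split; last exact: pushdown_pt_neq0.
  exact: pushdown_local_end.
- by move/pushdown_phom_exists.
- move/pushdown_theta_isomorphic => h; apply: (nM q q' n); apply: h => //.
  + by case: (locM q).
  + by case: (locM q').
Qed.

(** The three conditions of non-symmetry say that there are no isomorphisms
    with nontrivial twists inside the first chain, inside the second, and among
    the pushouts; each yields locality and reflection of isomorphisms there. *)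
Lemma pushdown_independent_pair (d1 d2 : Order.disp_t) (L1 : porderType d1)
    (L2 : porderType d2) (M : L1 -> pmod theta) (N : L2 -> pmod theta) :
  independent_pair M N -> non_symmetric act M N ->
  independent_pair (fun q => F (M q)) (fun t => F (N t)).
Proof.
move=> [dcM dcN locP nP] ns.
(* Non-symmetry speaks of indices of both chains at once, so using it for one
   chain needs an index of the other. *)
have [q0] : inhabited L1 by apply: rational_chain_inhabited; case: dcM.
have [t0] : inhabited L2 by apply: rational_chain_inhabited; case: dcN.
have dP q q' t t' :
    twist_disjoint act (ppushout (M q) (N t)) (ppushout (M q') (N t')).
  by move=> g n; case: (ns g n q q' t t').
have nF q q' t t' :
    ~ theta_isomorphic (ppushout (M q) (N t)) (ppushout (M q') (N t')) ->
    ~ theta_isomorphic (ppushout (F (M q)) (F (N t)))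
                       (ppushout (F (M q')) (F (N t'))).
  move=> n iF; apply: n; apply: pushdown_theta_isomorphic => //.
  apply: theta_isomorphic_trans (pushdown_ppushout _ _).
  exact: theta_isomorphic_trans
    (theta_isomorphic_sym (pushdown_ppushout _ _)) iF.
split.
- by apply: pushdown_dense_chain => // q q' g n; case: (ns g n q q' t0 t0).
- by apply: pushdown_dense_chain => // t t' g n; case: (ns g n q0 q0 t t').
- move=> q t; have [f [_ if_]] := pushdown_ppushout (M q) (N t).
  apply: (local_end_iso (isomorphic_sym (ex_intro _ f if_))).
  exact: pushdown_local_end.
- move=> q q' t t' nq nt; have [a b] := nP q q' t t' nq nt.
  by split; apply: nF.
Qed.

End PushdownPointed.

Theorem theorem1p1
    (K : closedFieldType) (charK : 2%N \notin [pchar K]%R)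
    (Q : quiver) (Lam : falgType K)
    (pi : {lrmorphism path_alg K Q -> Lam})
    (pi_bound : bound_quiver_algebra pi)
    (gT : finGroupType) (abG : abelian [set: gT])
    (actQ : alg_action gT (path_alg K Q)) (act : alg_action gT Lam)
    (pi_equivariant : forall g x, pi (actQ g x) = act g (pi x))
    (vact : gT -> qvert Q -> qvert Q)
    (vact_perm : permutes_vertices actQ vact)
    (vact_orbits : forall i : qvert Q,
        vstab vact i <> [set: gT] -> #|vorbit vact i| = #|gT|)
    (dualG : num_irreducibles K gT #|gT|)
    (F_semi_covering : galois_semi_covering act)
    (theta : amod Lam) (theta_semisimple : semisimple theta) :
  (forall (d1 d2 : Order.disp_t) (L1 : porderType d1) (L2 : porderType d2)
          (M : L1 -> pmod theta) (N : L2 -> pmod theta),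
      independent_pair M N -> non_symmetric act M N ->
      independent_pair (fun q => pushdown_pmod act (M q))
                       (fun t => pushdown_pmod act (N t)))
  /\
  (forall (L1 : Type) (M : L1 -> pmod theta),
      wide (pfamily_classes M) ->
      wide (pfamily_classes (fun p => pushdown_pmod act (M p)))).
Proof.
split=> [d1 d2 L1 L2 M N|L1 M]; first exact: pushdown_independent_pair.
exact: pushdown_wide.
Qed.
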